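(* Every cubic Halin graph is $(1,1,2,3)$-packing colorable. That is, for every cubic Halin graph $G$ there is a partition of $V(G)$ into (possibly empty) sets $V_1,V_2,V_3,V_4$ such that, with $(s_1,s_2,s_3,s_4)=(1,1,2,3)$, for each $1\le i\le 4$ any two distinct vertices $u,v\in V_i$ satisfy $d_G(u,v)\ge s_i+1$.
   Context: Graphs are finite and simple (no loops or multiple edges); $d_G(u,v)$ denotes the distance between $u$ and $v$ in $G$. For a non-decreasing sequence $S=(s_1,\dots,s_k)$ of positive integers, an $S$-packing coloring of a graph $G$ is a partition of $V(G)$ into $k$ subsets $V_1,\dots,V_k$ (some of which may be empty) such that for each $1\le i\le k$ any two distinct vertices $u,v\in V_i$ satisfy $d_G(u,v)\ge s_i+1$; $G$ is $S$-packing colorable if it has such a coloring. A Halin graph is a planar graph $G=T\cup C$ obtained from a tree $T$ of order at least four, in which each vertex has degree either one (a leaf) or at least $3$, by connecting the leaves of $T$ into a cycle $C$ (so $V(G)=V(T)$, $V(C)$ is exactly the set of leaves of $T$, and $E(G)=E(T)\cup E(C)$, with $G$ planar). A graph is cubic if every vertex has degree $3$. *)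

(* Defs.v *)
From mathcomp Require Import all_boot all_order all_algebra.
From mathcomp Require Import all_classical all_reals all_analysis.
Import numFieldNormedType.Exports.

Set Implicit Arguments.
Unset Strict Implicit.
Unset Printing Implicit Defensive.

(* A finite simple graph with vertex set V. Having V as a parameter lets a
   graph and its spanning subgraphs live on the same vertices. *)
Record sgraph (V : finType) := SGraph {
  adj :> rel V;
  adj_sym : symmetric adj;
  adj_irrefl : irreflexive adj
}.

Section Graphs.
Variable V : finType.
Implicit Types (G T : sgraph V) (x y u v : V) (c : seq V).

Definition degree G x : nat := #|[pred y | G x y]|.

Definition cubic G : Prop := forall x, degree G x = 3.

Definition walk G x y (n : nat) : bool :=
  [exists p : n.-tuple V, path G x p && (last x p == y)].

(* The length of a shortest walk, None standing for an infinite distance.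
   Only lengths below #|V| need to be searched: see distP. *)
Definition dist G x y : option nat :=
  let d := find (walk G x y) (iota 0 #|V|) in
  if d < #|V| then Some d else None.

Definition dist_ge (d : option nat) (m : nat) : bool :=
  if d is Some n then m <= n else true.

(* A partition of V into possibly empty classes V_i, indexed from 0. *)
Definition packing_coloring (S : seq nat) G (P : 'I_(size S) -> {set V}) :=
  (forall x, exists! i, x \in P i) /\
  (forall i u v, u \in P i -> v \in P i -> u != v ->
     dist_ge (dist G u v) (nth 0 S i + 1)).

Definition packing_colorable (S : seq nat) G : Prop :=
  exists P : 'I_(size S) -> {set V}, packing_coloring G P.

Definition connected_graph G : Prop :=
  0 < #|V| /\ forall x y, connect G x y.

(* ucycle also accepts [::] and, for an edge xy, the sequence [:: x; y]. *)
Definition acyclic G : Prop := forall c, ucycle G c -> size c <= 2.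

Definition tree G : Prop := connected_graph G /\ acyclic G.

Definition leaf G x : bool := degree G x == 1.

(* The edges of the cycle visiting the vertices of c in order (c is meant to
   be duplicate-free, of size at least 3). *)
Definition cycle_edge c : rel V :=
  [rel x y | [&& x \in c, y \in c & (next c x == y) || (next c y == x)]].

End Graphs.

Section Planarity.
Local Open Scope classical_set_scope.
Local Open Scope ring_scope.

(* A drawing of G in the plane R * R without crossings: vertices are distinct
   points, the edge xy is the simple arc [arc x y] from x to y parametrized by
   [0, 1] (and [arc y x] is the same arc run backwards), and the interior of an
   arc meets neither a vertex nor the interior of the arc of another edge. *)
Record plane_drawing (R : realType) (V : finType) (G : sgraph V)
    (pt : V -> R * R) (arc : V -> V -> R -> R * R) : Prop := PlaneDrawing {
  pt_inj : injective pt;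
  arc_continuous : forall x y, G x y -> {within `[0, 1], continuous (arc x y)};
  arc_simple : forall x y, G x y -> {in `[0, 1] &, injective (arc x y)};
  arc_source : forall x y, G x y -> arc x y 0 = pt x;
  arc_target : forall x y, G x y -> arc x y 1 = pt y;
  arc_reverse : forall x y (t : R), G x y -> t \in `[0, 1] ->
    arc y x t = arc x y (1 - t);
  arc_avoids_pt : forall x y z (t : R),
    G x y -> t \in `]0, 1[ -> arc x y t <> pt z;
  arc_disjoint : forall x y u v (s t : R), G x y -> G u v ->
    (u, v) != (x, y) -> (u, v) != (y, x) ->
    s \in `]0, 1[ -> t \in `]0, 1[ -> arc x y s <> arc u v t
}.

Definition planar (R : realType) (V : finType) (G : sgraph V) : Prop :=
  exists (pt : V -> R * R) (arc : V -> V -> R -> R * R),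
    plane_drawing G pt arc.

End Planarity.

Definition halin (R : realType) (V : finType) (G : sgraph V) : Prop :=
  planar R G /\
  exists (T : sgraph V) (c : seq V),
    [/\ tree T /\ 4 <= #|V|,
        forall x, leaf T x \/ 3 <= degree T x,
        uniq c /\ 3 <= size c,
        (forall x, (x \in c) = leaf T x)
      & forall x y, G x y = T x y || cycle_edge c x y].

Section Distance.
Variables (V : finType) (G : sgraph V).
Implicit Types x y : V.

Lemma walkP x y n :
  reflect (exists p, [/\ path G x p, last x p = y & size p = n]) (walk G x y n).
Proof.
apply: (iffP existsP) => [[p /andP[Gp /eqP lp]]|[p [Gp lp sp]]].
  by exists p; rewrite size_tuple.
have sp' : size p == n by apply/eqP.
by exists (Tuple sp'); rewrite /= Gp lp eqxx.
Qed.

Lemma walk_short x y n :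
  walk G x y n -> exists m, [/\ m <= n, m < #|V| & walk G x y m].
Proof.
move=> /walkP[p [Gp lp <-]]; move: lp; case/shortenP: Gp => q Gq Uq sub_qp lq.
exists (size q); split; last by apply/walkP; exists q.
  by apply: uniq_leq_size => //; case/andP: Uq.
by rewrite -[(size q).+1]/(size (x :: q)) -(card_uniqP Uq) max_card.
Qed.

Lemma distP x y :
  match dist G x y with
  | Some d => walk G x y d /\ forall m, walk G x y m -> d <= m
  | None => forall m, ~~ walk G x y m
  end.
Proof.
rewrite /dist; set d := find _ _; case: ifP => dV.
  have hasw : has (walk G x y) (iota 0 #|V|) by rewrite has_find size_iota.
  split; first by have := nth_find 0 hasw; rewrite nth_iota.
  move=> m /walk_short[k [km kV wk]]; apply: leq_trans km.
  rewrite leqNgt; apply/negP => kd.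
  by have := before_find 0 kd; rewrite nth_iota // add0n wk.
move=> m; apply/negP => /walk_short[k [_ kV wk]].
have : has (walk G x y) (iota 0 #|V|).
  by apply/hasP; exists k; rewrite // mem_iota.
by rewrite has_find size_iota -/d dV.
Qed.

End Distance.

(* Main.v *)
Require Import Defs.
From mathcomp Require Import all_boot all_order all_algebra.
From mathcomp Require Import all_classical all_reals all_analysis.
From mathcomp Require Import lra.
From Stdlib Require Import Btauto.

Set Implicit Arguments.
Unset Strict Implicit.
Unset Printing Implicit Defensive.

(** A packing colouring amounts to two sets P2 and P3, of pairwise distance at
    least 3 and at least 4 respectively, whose removal leaves a bipartite graph.
    Say that P2 consists of the vertices of colour 2, and P3 of those of
    colour 3. Both are taken mostly among the leaves of the tree T, so that
    enough edges of the cycle C are destroyed for the rest to be essentially a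
    forest.

    Planarity is used through one consequence, [exit_unique]: the leaves on
    one side of an edge xy of T are consecutive on C. If they were not, they
    would be left twice along C, after the leaves v and w say, and the vertices
    v, w, x on the one hand and [next v], [next w], y on the other would be the
    branch vertices of a subdivided K33, made of C, of xy and of walks of T on
    either side of xy. That K33 has no plane drawing is shown by sampling the
    arcs finely ([planar_no_k33]) and counting crossings modulo 2 between the
    resulting discrete curves ([k33_obstruction]).

    Let the leaves be numbered from 0 to n - 1 along C. Mark every second leaf,
    alternately with 2 and with 3. When 4 divides n, every edge of C has a marked
    end, and two leaves with the same mark are at distance 4 or more along C
    ([packing_mod0]). For other n the pattern is started at a cherry, that is at
    an internal vertex u adjacent to the leaves 0 and 1: the only edges of C
    without a marked end are at the leaf 0, and u itself gets colour 2 when n is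
    1 or 2 modulo 4 ([packing_mod12]), and colour 3 when n is 3 modulo 4
    ([packing_mod3]).

    Since siblings are consecutive on C, a short walk between two leaves either
    can be replaced by a walk along C or runs through their two parents
    ([leaf_walk3]). So the only thing that can go wrong among marked leaves is
    a conflict: two leaves l and l' marked 3 whose parents are adjacent. It is
    repaired by taking the mark from the leaf whose parent is further from u, l'
    say, and giving colour 2 to the parent of l'. Consider the third branch Q at
    that parent. By the arc property its leaves fill C between l and l' on one
    side ([between]), and a leaf hanging from the root of Q is next to l or l'
    ([outer_leaf]), hence unmarked. Therefore all marks other than those of l and
    l' are so far away that repairs do not disturb each other ([far_hub],
    [far_hub_X2]). The rest is still bipartite: l' only keeps its two edges on C,
    one towards Q and one away from it, and Q is attached to the rest of the tree
    through a vertex of colour 2, so the colours in Q can be exchanged until both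
    neighbours of l' agree ([two_coloring]). This is [repaired_packing].

    It remains to keep u away from the other vertices of its colour, which
    requires some care in choosing the cherry. It is taken at an end of the tree
    ([end_of_tree]), where the neighbour w of u is also adjacent to a leaf or to
    a second cherry; by [orient_leaf] and [orient_cherries] the leaves of these
    can be assumed to follow the leaves 0 and 1. The cases are put together in
    [frame_packing]. *)

(** * Crossing parity of discrete curves *)

Lemma mem_tail (T : eqType) (x y : T) s : x \in s -> x \in y :: s.
Proof. by rewrite inE orbC => ->. Qed.

Section CrossingParity.
Import Order.TTheory GRing.Theory Num.Theory.
Local Open Scope ring_scope.
Variables (R : realDomainType) (d : R).
Local Notation point := (R * R)%type.
Implicit Types (p q z w : point) (ps qs : seq point).

Definition vec p q : point := (p.1 - q.1, p.2 - q.2).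

(** The horizontal axis is shared out so that a nonzero point and its opposite
    are never both [upper]: see [axis_opp]. *)
Definition upper z : bool := (0 < z.2) || (z.2 == 0) && (0 < z.1).

(** Whether the step from [z] to [w] crosses the positive horizontal half-axis.
    The sign is tested at [z] only: a short step far from the origin that
    crosses the horizontal axis cannot cross the vertical one. *)
Definition axis z w : bool := (upper z (+) upper w) && (0 < z.1).

Definition near_pt p q : bool :=
  (`|p.1 - q.1| < d) && (`|p.2 - q.2| < d).

Definition far_pt p q : bool :=
  (d *+ 2 <= `|p.1 - q.1|) || (d *+ 2 <= `|p.2 - q.2|).

Lemma near_ptC p q : near_pt p q = near_pt q p.
Proof. by rewrite /near_pt (distrC p.1) (distrC p.2). Qed.

(** When two curves make steps shorter than [d], the difference of their points
    makes steps shorter than [d *+ 2], hence the factor here and in [far_pt]. *)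
Definition near0 z w := (`|z.1 - w.1| < d *+ 2) && (`|z.2 - w.2| < d *+ 2).
Definition far0 z := (d *+ 2 <= `|z.1|) || (d *+ 2 <= `|z.2|).

(** With [f := vec p], the number modulo 2 of the crossings of the half-line
    going left from [p]; with [f := vec^~ p], of the half-line going right. *)
Fixpoint turns (f : point -> point) p ps : bool :=
  if ps is p' :: ps' then axis (f p) (f p') (+) turns f p' ps' else false.

Lemma same_sign (a b : R) :
  `|a - b| < d *+ 2 -> d *+ 2 <= `|a| -> (0 < b) = (0 < a) /\ (b == 0) = false.
Proof.
rewrite ltr_norml ler_normr => /andP[h1 h2] h3.
have [a0|a0|a0] := ltrgt0P a; split.
- by apply/idP; move/orP: h3 => [?|?]; lra.
- by apply/eqP => b0; move/orP: h3 => [?|?]; lra.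
- by apply/idP/idP => //; move/orP: h3 => [?|?]; lra.
- by apply/eqP => b0; move/orP: h3 => [?|?]; lra.
- by apply/idP/idP => //; move/orP: h3 => [?|?]; lra.
- by apply/eqP => b0; move/orP: h3 => [?|?]; lra.
Qed.

Lemma upper_near z w : near0 z w -> d *+ 2 <= `|z.2| -> upper w = upper z.
Proof.
move=> /andP[_ zw] z2; have [e n] := same_sign zw z2.
have zz : `|z.2 - z.2| < d *+ 2 by rewrite subrr normr0; move: zw; rewrite ltr_norml; lra.
by have [_ n'] := same_sign zz z2; rewrite /upper e n n' !orbF.
Qed.

(** Going around a small square far from the origin crosses the half-axis an
    even number of times: either the square stays on one side of the
    horizontal axis, or it stays on one side of the vertical one. *)
Lemma axis_square z00 z10 z01 z11 :
  far0 z00 -> far0 z10 -> far0 z01 -> far0 z11 ->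
  near0 z00 z10 -> near0 z00 z01 -> near0 z00 z11 -> near0 z10 z01 ->
  near0 z10 z11 -> near0 z01 z11 ->
  axis z00 z10 (+) axis z01 z11 (+) (axis z00 z01 (+) axis z10 z11) = false.
Proof.
have near0C z w : near0 z w -> near0 w z by rewrite /near0 (distrC z.1) (distrC z.2).
move=> f00 f10 f01 f11 n1 n2 n3 n4 n5 n6.
have [h|/negbTE h00] := boolP (d *+ 2 <= `|z00.2|).
  by rewrite /axis !(upper_near _ h) // !addbb.
have [h|/negbTE h10] := boolP (d *+ 2 <= `|z10.2|).
  by rewrite /axis !(upper_near _ h) ?addbb //; apply: near0C.
have [h|/negbTE h01] := boolP (d *+ 2 <= `|z01.2|).
  by rewrite /axis !(upper_near _ h) ?addbb //; apply: near0C.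
have [h|/negbTE h11] := boolP (d *+ 2 <= `|z11.2|).
  by rewrite /axis !(upper_near _ h) ?addbb //; apply: near0C.
move: f00; rewrite /far0 h00 orbF => f00.
have [/same_sign -/(_ f00)[e10 _] /same_sign -/(_ f00)[e01 _]] :
   `|z00.1 - z10.1| < d *+ 2 /\ `|z00.1 - z01.1| < d *+ 2.
  by case/andP: n1; case/andP: n2.
rewrite /axis e10 e01.
by case: (upper z00); case: (upper z10); case: (upper z01); case: (upper z11);
   case: (0 < z00.1).
Qed.

(** The reflection exchanges the positive and the negative half-axis, and a step
    crosses exactly one of them when its ends are on different sides. *)
Lemma axis_opp z w : far0 z -> far0 w -> near0 z w ->
  axis (- z.1, - z.2) (- w.1, - w.2) = axis z w (+) (upper z (+) upper w).
Proof.
move=> fz fw nzw.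
have upperN v : far0 v -> 0 < d -> upper (- v.1, - v.2) = ~~ upper v.
  case: v => a b; rewrite /far0 /upper /= => fv d0.
  rewrite !oppr_gt0 oppr_eq0.
  have [b0|b0|b0] := ltrgt0P b => //=.
  move: fv; rewrite b0 normr0.
  have [a0|a0|a0] := ltrgt0P a => //=; rewrite orbC ?normr0 /= => fa; lra.
have d0 : 0 < d.
  by case/andP: nzw; rewrite ltr_norml => /andP[h1 h2] _; lra.
rewrite /axis !upperN //=.
have [e|ne] := eqVneq (upper z) (upper w); first by rewrite e !addbb.
have z20 : d *+ 2 <= `|z.2| = false.
  by apply/negP => /(upper_near nzw) e; rewrite e eqxx in ne.
move: fz; rewrite /far0 z20 orbF oppr_gt0 => z1.
have zn0 : z.1 != 0.
  by apply/eqP => z0; move: z1; rewrite z0 normr0; lra.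
move: zn0 ne.
by have [||] := ltrgt0P z.1 => //; case: (upper z); case: (upper w).
Qed.

Lemma near0_vec p p' q q' : near_pt p p' || (p == p') ->
  near_pt q q' || (q == q') -> 0 < d -> near0 (vec p q) (vec p' q').
Proof.
move=> hp hq d0.
have aux (a b : R * R) : near_pt a b || (a == b) ->
   [/\ - d < a.1 - b.1, a.1 - b.1 < d, - d < a.2 - b.2 & a.2 - b.2 < d].
  case/orP => [/andP[]|/eqP->]; rewrite ?ltr_norml.
    by move=> /andP[-> ->] /andP[-> ->].
  by rewrite !subrr oppr_lt0 d0.
have [p1 p2 p3 p4] := aux _ _ hp; have [q1 q2 q3 q4] := aux _ _ hq.
by rewrite /near0 /vec /= !ltr_norml; apply/andP; split; apply/andP; split; lra.
Qed.

(** The sum of [axis_square] over a row of the grid of differences [p - q]. *)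
Lemma turns_strip p p' q qs : near_pt p p' -> path near_pt q qs -> 0 < d ->
  (forall q', q' \in q :: qs -> far_pt p q' && far_pt p' q') ->
  axis (vec p q) (vec p' q) (+) axis (vec p (last q qs)) (vec p' (last q qs))
    = turns (vec p) q qs (+) turns (vec p') q qs.
Proof.
move=> pp' + d0; elim: qs q => [|q1 qs IH] q /=; first by rewrite !addbb.
move=> /andP[qq1 qp] far.
have {}IH := IH _ qp (fun q' h => far q' (mem_tail _ h)).
have /andP[f1 f2] := far q (mem_head _ _).
have /andP[f3 f4] := far q1 (mem_tail _ (mem_head _ _)).
have := @axis_square (vec p q) (vec p' q) (vec p q1) (vec p' q1) f1 f2 f3 f4.
rewrite !near0_vec ?(near_ptC p') ?pp' ?qq1 ?eqxx ?orbT //.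
move=> /(_ isT isT isT isT isT isT).
move: IH; move: (axis _ _) (axis _ _) (axis _ _) (axis _ _) (turns _ _ _) (turns _ _ _).
move=> a b c e f g.
by case: a; case: b; case: c; case: e; case: f; case: g; case: (axis _ _).
Qed.

(** The differences of the points of two curves far apart form a grid of small
    squares that avoids the origin. Crossings inside the grid cancel, so those on
    its boundary are even in number. *)
Lemma turns_rect p ps q qs :
  path near_pt p ps -> path near_pt q qs -> 0 < d ->
  (forall p' q', p' \in p :: ps -> q' \in q :: qs -> far_pt p' q') ->
  turns (vec^~ q) p ps (+) turns (vec^~ (last q qs)) p ps
    = turns (vec p) q qs (+) turns (vec (last p ps)) q qs.
Proof.
move=> + qp d0; elim: ps p => [|p1 ps IH] p /=; first by rewrite !addbb.
move=> /andP[pp1 pth] far.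
have {}IH := IH _ pth (fun p' q' h => far p' q' (mem_tail _ h)).
have far2 q' : q' \in q :: qs -> far_pt p q' && far_pt p1 q'.
  by move=> hq; rewrite !far // ?inE ?eqxx ?orbT.
move: (turns_strip pp1 qp d0 far2) IH.
move: (turns _ _ _) (turns _ _ _) (turns _ _ _) (turns _ _ _) (turns _ _ _)
  (axis _ _) (axis _ _).
by do 7 case.
Qed.

Lemma turns_opp p q qs : path near_pt q qs -> 0 < d ->
  (forall q', q' \in q :: qs -> far_pt q' p) ->
  turns (vec p) q qs
    = turns (vec^~ p) q qs (+) (upper (vec q p) (+) upper (vec (last q qs) p)).
Proof.
move=> + d0; elim: qs q => [|q1 qs IH] q /=; first by rewrite addbb.
move=> /andP[qq1 qp] far.
rewrite (IH _ qp (fun q' h => far q' (mem_tail _ h))).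
have oppv v : vec p v = (- (vec v p).1, - (vec v p).2).
  by rewrite /vec /= !opprB.
rewrite (oppv q) (oppv q1) axis_opp ?near0_vec ?qq1 ?eqxx ?orbT //.
- by case: (axis _ _); case: (upper _); case: (upper _); case: (upper _); case: (turns _ _).
- exact: (far q (mem_head _ _)).
- exact: (far q1 (mem_tail _ (mem_head _ _))).
Qed.

Lemma upper_anti v w : 0 < d -> far_pt v w ->
  upper (vec w v) = ~~ upper (vec v w).
Proof.
move=> d0; rewrite /far_pt /upper /vec /= => fvw.
rewrite !subr_gt0 !subr_eq0.
have [v2|v2|v2] := ltrgtP v.2 w.2 => //=.
have [v1|v1|v1] := ltrgtP v.1 w.1 => //=.
by move: fvw; rewrite v1 v2 !subrr normr0 orbb => ?; lra.
Qed.

(** A form of [turns_rect] that treats the two curves alike; the order of their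
    ends is what remains of the exchange of the two half-axes. *)
Lemma turns_sym p ps q qs :
  path near_pt p ps -> path near_pt q qs -> 0 < d ->
  (forall p' q', p' \in p :: ps -> q' \in q :: qs -> far_pt p' q') ->
  forall p' q', p' = last p ps -> q' = last q qs ->
  turns (vec^~ q) p ps (+) turns (vec^~ q') p ps
    (+) (turns (vec^~ p) q qs (+) turns (vec^~ p') q qs)
    (+) (upper (vec p q) (+) upper (vec p q')
           (+) (upper (vec p' q) (+) upper (vec p' q'))) = false.
Proof.
move=> pth qth d0 far p' q' -> ->.
have far' v : v \in p :: ps -> forall q', q' \in q :: qs -> far_pt q' v.
  move=> hv w hw; move: (far v w hv hw).
  by rewrite /far_pt (distrC v.1) (distrC v.2).
have hp := mem_head p ps; have hl := mem_last p ps.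
have kp := mem_head q qs; have kl := mem_last q qs.
rewrite (turns_rect pth qth d0 far) !(turns_opp qth d0) => [|v hv|v hv];
  do ?exact: far'.
rewrite !(upper_anti d0 (v := p)) ?(upper_anti d0 (v := last p ps)) ?far //.
move: (turns _ _ _) (turns _ _ _) (upper _) (upper _) (upper _) (upper _).
by do 6 case.
Qed.

(** This is the van Kampen obstruction modulo 2. Sum [turns_sym] over the 18
    pairs of independent edges of K33. How an edge turns around a vertex is
    counted twice, for the two independent edges at this vertex. The order of
    two vertices [a i], [a k] is counted six times, that of [a i], [b l] four
    times. But the order of [b j], [b l] is counted with both signs, for each of
    the three pairs of [a i], [a k], so that the total is odd. *)
Lemma k33_obstruction (a b : 'I_3 -> point) (s : 'I_3 -> 'I_3 -> seq point) :
  0 < d ->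
  (forall i j, last (a i) (s i j) = b j) ->
  (forall i j, path near_pt (a i) (s i j)) ->
  (forall i j k l, i != k -> j != l ->
     forall p q, p \in a i :: s i j -> q \in a k :: s k l -> far_pt p q) ->
  False.
Proof.
move=> d0 lasts paths fars.
pose w1 i j k := turns (vec^~ (a k)) (a i) (s i j).
pose w2 i j l := turns (vec^~ (b l)) (a i) (s i j).
pose u1 i k := upper (vec (a i) (a k)).
pose u2 i l := upper (vec (a i) (b l)).
pose u3 j l := upper (vec (b j) (b l)).
have memb i j : b j \in a i :: s i j by rewrite -(lasts i j) mem_last.
have E i j k l : i != k -> j != l ->
    w1 i j k (+) w2 i j l (+) (w1 k l i (+) w2 k l j)
      (+) (u1 i k (+) u2 i l (+) (~~ u2 k j (+) u3 j l)) = false.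
  move=> ik jl; have far := fars i j k l ik jl.
  have ab : far_pt (a k) (b j).
    rewrite /far_pt (distrC (a k).1) (distrC (a k).2).
    exact: far (memb i j) (mem_head _ _).
  have := turns_sym (paths i j) (paths k l) d0 far (esym (lasts i j))
            (esym (lasts k l)).
  by rewrite (upper_anti d0 ab).
have u3_anti j l : j != l -> u3 l j = ~~ u3 j l.
  move=> jl; apply: upper_anti => //.
  exact: (fars ord0 j ord_max l isT jl _ _ (memb _ _) (memb _ _)).
pose i0 : 'I_3 := ord0; pose i2 : 'I_3 := ord_max.
pose i1 : 'I_3 := @Ordinal 3 1 isT.
move: (u3_anti i0 i1 isT) (u3_anti i0 i2 isT) (u3_anti i1 i2 isT).
move: (E i0 i0 i1 i1 isT isT) (E i0 i0 i1 i2 isT isT) (E i0 i1 i1 i0 isT isT)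
  (E i0 i1 i1 i2 isT isT) (E i0 i2 i1 i0 isT isT) (E i0 i2 i1 i1 isT isT)
  (E i0 i0 i2 i1 isT isT) (E i0 i0 i2 i2 isT isT) (E i0 i1 i2 i0 isT isT)
  (E i0 i1 i2 i2 isT isT) (E i0 i2 i2 i0 isT isT) (E i0 i2 i2 i1 isT isT)
  (E i1 i0 i2 i1 isT isT) (E i1 i0 i2 i2 isT isT) (E i1 i1 i2 i0 isT isT)
  (E i1 i1 i2 i2 isT isT) (E i1 i2 i2 i0 isT isT) (E i1 i2 i2 i1 isT isT).
move=> e1 e2 e3 e4 e5 e6 e7 e8 e9 e10 e11 e12 e13 e14 e15 e16 e17 e18 h1 h2 h3.
have add x y : x = false -> y = false -> x (+) y = false by move=> -> ->.
have := add _ _ e1 (add _ _ e2 (add _ _ e3 (add _ _ e4 (add _ _ e5 (add _ _ e6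
  (add _ _ e7 (add _ _ e8 (add _ _ e9 (add _ _ e10 (add _ _ e11 (add _ _ e12
  (add _ _ e13 (add _ _ e14 (add _ _ e15 (add _ _ e16 (add _ _ e17 e18
  )))))))))))))))).
rewrite h1 h2 h3.
have addE x y : x (+) y = xorb x y by case: x; case: y.
rewrite !addE.
match goal with |- ?x = false -> _ => suff -> : x = true by [] end.
btauto.
Qed.

End CrossingParity.

(** * Compactness of arcs *)

Section Curves.
Import Order.TTheory GRing.Theory Num.Theory.
Import numFieldNormedType.Exports.
Local Open Scope classical_set_scope.
Local Open Scope ring_scope.
Variable R : realType.
Implicit Types f g : R -> R * R.

Lemma curve_uniformly_continuous f (d : R) :
  0 < d -> {within `[0, 1], continuous f} ->
  exists N0 : nat, forall N, (N0 <= N)%N -> forall s t : R,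
    s \in `[0, 1] -> t \in `[0, 1] -> `|s - t| <= N.+1%:R^-1 ->
    near_pt d (f s) (f t).
Proof.
move=> d0 cf.
have /compact_near_coveringP/near_covering_withinP := @segment_compact R 0 1.
move=> /(_ nat \oo (fun N s => forall t : R,
   t \in `[0, 1] -> `|s - t| <= N.+1%:R^-1 -> near_pt d (f s) (f t))).
case=> [|N0 _ H]; last first.
  exists N0 => N N0N s t s01 t01 st.
  by have := H N N0N s s01; apply.
move=> s s01.
have d2 : 0 < d / 2 by lra.
have /subspace_continuousP/(_ s s01)/cvgrPdist_lt/(_ _ d2) := cf.
rewrite /within /= => /nbhs_ballP[r /= r0 Hr].
have r2 : 0 < r / 2 by lra.
have close (t : R) : t \in `[0, 1] -> `|s - t| < r -> near_pt (d / 2) (f s) (f t).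
  move=> t01 st; have := Hr t; rewrite -ball_normE /= => /(_ st t01).
  by rewrite prod_normE /= gt_max.
near=> s' N => s'01 t t01 s't.
have ss' : `|s - s'| < r / 2.
  by near: s'; apply/nbhs_ballP; exists (r / 2) => //= x; rewrite -ball_normE.
have Nr : N.+1%:R^-1 < r / 2.
  by near: N; exact: near_infty_natSinv_lt (PosNum r2).
have st : `|s - t| < r.
  rewrite -(subrKA s'); apply: le_lt_trans (ler_normD _ _) _.
  by rewrite [r in _ < r]splitr ltrD // (le_lt_trans s't).
have ss'r : `|s - s'| < r by apply: lt_trans ss' _; rewrite ltr_pdivrMr ?ltr_pMr ?ltr1n.
have /andP[h1 h2] := close _ t01 st; have /andP[h3 h4] := close _ s'01 ss'r.
move: h1 h2 h3 h4; rewrite /near_pt !ltr_norml => h1 h2 h3 h4.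
by apply/andP; split; apply/andP; split; lra.
Unshelve. all: by end_near.
Qed.

(** The differences [f s - g t] form a compact set without the origin, which
    therefore misses a ball around it. The conclusion holds for all smaller
    distances, so that finitely many pairs of curves can be treated together. *)
Lemma disjoint_curves_apart f g :
  {within `[0, 1], continuous f} -> {within `[0, 1], continuous g} ->
  (forall s t : R, s \in `[0, 1] -> t \in `[0, 1] -> f s <> g t) ->
  exists2 d : R, 0 < d & forall d', d' <= d -> forall s t : R, s \in `[0, 1] -> t \in `[0, 1] ->
    far_pt d' (f s) (g t).
Proof.
move=> cf cg fg.
have cK := compact_setX (continuous_compact cf (@segment_compact R 0 1))
                        (continuous_compact cg (@segment_compact R 0 1)).
pose D := [set p.1 - p.2 | p in
   (f @` `[0, 1]) `*` (g @` `[0, 1])].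
have cD : compact D.
  apply: continuous_compact cK; apply: continuous_subspaceT => p.
  by apply: cvgB; [exact: cvg_fst | exact: cvg_snd].
have clD : closed D by apply: compact_closed => //; exact: norm_hausdorff.
have D0 : (~` D) 0.
  move=> [[p q] /= [[s s01 <-] [t t01 <-]]] /eqP.
  by rewrite subr_eq0 => /eqP; apply: fg.
have /nbhs_ballP[e /= e0 eD] : nbhs (0 : R * R) (~` D).
  by apply: open_nbhs_nbhs; split=> //; exact: closed_openC.
exists (e / 2) => [|d' d'e s t s01 t01]; first by lra.
apply: contrapT => /negP; rewrite /far_pt negb_or -!ltNge => /andP[h1 h2].
apply: (eD (f s - g t)); last by exists (f s, g t); split=> //=; [exists s | exists t].
rewrite -ball_normE /= sub0r normrN prod_normE /= gt_max.
by apply/andP; split; apply: lt_le_trans h1 _ || apply: lt_le_trans h2 _; rewrite mulr2n; lra.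
Qed.
End Curves.

(** * A planar graph contains no subdivided K33 *)

Section Drawing.
Import Order.TTheory GRing.Theory Num.Theory.
Import numFieldNormedType.Exports.
Local Open Scope ring_scope.
Variables (R : realType) (V : finType) (G : sgraph V).

Lemma uniform_positive (I : finType) (P : I -> R -> Prop) :
  (forall i, exists2 d, 0 < d & forall d', d' <= d -> P i d') ->
  exists2 d, 0 < d & forall i, P i d.
Proof.
move=> H; suff [d d0 Hd] : exists2 d, 0 < d &
    forall i, i \in enum I -> forall d', d' <= d -> P i d'.
  by exists d => // i; apply: Hd; rewrite ?mem_enum.
elim: (enum I) => [|i s [d d0 IH]]; first by exists 1.
have [e e0 He] := H i; exists (Num.min d e); first by rewrite lt_min d0.
move=> j + d'; rewrite le_min inE => /orP[/eqP-> /andP[_]|js /andP[d'd _]].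
  exact: He.
exact: IH.
Qed.

Lemma uniform_large (I : finType) (P : I -> nat -> Prop) :
  (forall i, exists N0 : nat, forall N, (N0 <= N)%N -> P i N) ->
  exists N, forall i, P i N.
Proof.
move=> H; suff [N0 HN] : exists N0 : nat,
    forall i, i \in enum I -> forall N, (N0 <= N)%N -> P i N.
  by exists N0 => i; apply: HN; rewrite ?mem_enum.
elim: (enum I) => [|i s [N0 IH]]; first by exists 0%N.
have [N1 H1] := H i; exists (maxn N0 N1) => j + N.
rewrite geq_max inE => /orP[/eqP-> /andP[_]|js /andP[? _]]; first exact: H1.
exact: IH.
Qed.

Variables (pt : V -> R * R) (arc : V -> V -> R -> R * R).
Hypothesis drawn : plane_drawing G pt arc.

(** The starting point is left out, so that the samples of successive edges
    can be concatenated. *)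
Definition sample_arc N x y : seq (R * R) :=
  [seq arc x y (k.+1%:R / N.+1%:R) | k <- iota 0 N.+1].

Fixpoint sample_walk N x (p : seq V) : seq (R * R) :=
  if p is y :: p' then sample_arc N x y ++ sample_walk N y p' else [::].

Lemma sample_walk_cons N x y p :
  sample_walk N x (y :: p) = sample_arc N x y ++ sample_walk N y p.
Proof. by []. Qed.

Lemma unit_itv N k : (k <= N.+1)%N -> (k%:R / N.+1%:R : R) \in `[0, 1].
Proof.
by move=> kN; rewrite in_itv /= divr_ge0 //= ler_pdivrMr ?ltr0n // mul1r ler_nat.
Qed.

Lemma last_sample_arc N z x y : G x y -> last z (sample_arc N x y) = pt y.
Proof.
move=> Gxy; rewrite /sample_arc -{2}addn1 iotaD map_cat last_cat /= add0n.
by rewrite divff ?(arc_target drawn Gxy) // pnatr_eq0.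
Qed.

Lemma last_sample_walk N x p :
  path G x p -> last (pt x) (sample_walk N x p) = pt (last x p).
Proof.
elim: p x => [//|y p IH] x /andP[Gxy Gp].
by rewrite sample_walk_cons last_cat last_sample_arc // IH.
Qed.

Lemma path_sample_arc d N x y : G x y ->
  (forall s t : R, s \in `[0, 1] -> t \in `[0, 1] -> `|s - t| <= N.+1%:R^-1 ->
    near_pt d (arc x y s) (arc x y t)) ->
  path (near_pt d) (pt x) (sample_arc N x y).
Proof.
move=> Gxy near; rewrite -(arc_source drawn Gxy).
have -> : arc x y 0 = arc x y (0%:R / N.+1%:R) by rewrite mul0r.
suff H m k : (k + m <= N.+1)%N -> path (near_pt d) (arc x y (k%:R / N.+1%:R))
    [seq arc x y (i.+1%:R / N.+1%:R) | i <- iota k m] by exact: (H N.+1 0%N).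
elim: m k => [//|m IH] k kN; rewrite /=.
have kN' : (k.+1 <= N.+1)%N by rewrite (leq_trans _ kN) // addnS ltnS leq_addr.
rewrite (IH k.+1) ?addSnnS // andbT near ?unit_itv ?(ltnW kN') //.
rewrite -mulrBl -natr1 opprD addrA subrr sub0r mulN1r normrN.
by rewrite ger0_norm // invr_ge0.
Qed.

Lemma sample_walkP N x p z : path G x p -> p != [::] ->
  z \in pt x :: sample_walk N x p ->
  exists u v t, [/\ G u v, u \in x :: p, v \in x :: p, t \in `[0, 1] & z = arc u v t].
Proof.
have sub y q : path G y q -> z \in sample_walk N y q ->
    exists u v t, [/\ G u v, u \in y :: q, v \in y :: q, t \in `[0, 1] & z = arc u v t].
  elim: q y => [//|v q IH] y /andP[Gyv Gq]; rewrite sample_walk_cons mem_cat => /orP[|zq].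
    case/mapP=> k; rewrite mem_iota add0n => /= kN ->.
    by exists y, v, (k.+1%:R / N.+1%:R); rewrite unit_itv // !inE !eqxx orbT.
  have [u [w [t [Guw uq wq t01 ->]]]] := IH v Gq zq.
  by exists u, w, t; split; rewrite ?(mem_tail y).
move=> Gp pn0; rewrite inE => /orP[/eqP->|]; last exact: sub.
case: p Gp pn0 {sub} => //= y p /andP[Gxy _] _.
exists x, y, 0; split; rewrite ?(arc_source drawn Gxy) ?mem_head //.
  by rewrite mem_tail ?mem_head.
by rewrite in_itv /= lexx ler01.
Qed.

Lemma arcs_disjoint x y u v (s t : R) : G x y -> G u v ->
  x != u -> x != v -> y != u -> y != v ->
  s \in `[0, 1] -> t \in `[0, 1] -> arc x y s <> arc u v t.
Proof.
have ends z w r : G z w -> r \in `[0, 1] ->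
    [\/ arc z w r = pt z, arc z w r = pt w | r \in `]0, 1[].
  move=> Gzw; rewrite !in_itv /= => /andP[r0 r1].
  have [->|rn0] := eqVneq r 0; first by constructor 1; apply: (arc_source drawn).
  have [->|rn1] := eqVneq r 1; first by constructor 2; apply: (arc_target drawn).
  by constructor 3; rewrite !lt_neqAle rn1 r1 r0 eq_sym rn0.
move=> Gxy Guv xu xv yu yv s01 t01 e.
have inj p q : p != q -> pt p <> pt q by move=> /eqP pq /(pt_inj drawn).
have [es|es|si] := ends x y s Gxy s01; have [et|et|ti] := ends u v t Guv t01;
  try by move: e; rewrite es et; apply: inj.
- by apply: (arc_avoids_pt drawn (z := x) Guv ti); rewrite -e.
- by apply: (arc_avoids_pt drawn (z := y) Guv ti); rewrite -e.
- by apply: (arc_avoids_pt drawn (z := u) Gxy si); rewrite e.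
- by apply: (arc_avoids_pt drawn (z := v) Gxy si); rewrite e.
apply: (arc_disjoint drawn Gxy Guv) si ti e.
  by rewrite xpair_eqE eq_sym (negbTE xu).
by rewrite xpair_eqE eq_sym (negbTE yu).
Qed.

End Drawing.

Section NoK33.
Import Order.TTheory GRing.Theory Num.Theory.
Local Open Scope ring_scope.

(** Only the walks joining disjoint pairs of branch vertices have to be disjoint,
    because [k33_obstruction] compares independent edges only. Two walks with a
    common end may meet elsewhere, which spares choosing a genuine subdivision. *)
Lemma planar_no_k33 (R : realType) (V : finType) (G : sgraph V)
    (a b : 'I_3 -> V) (s : 'I_3 -> 'I_3 -> seq V) :
  planar R G ->
  (forall i j, path G (a i) (s i j)) ->
  (forall i j, last (a i) (s i j) = b j) ->
  (forall i j k l : 'I_3, (i < k)%N -> j != l ->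
     forall v, v \in a i :: s i j -> v \notin a k :: s k l) ->
  False.
Proof.
move=> [pt [arc drawn]] paths lasts disj'.
have disj (i j k l : 'I_3) : i != k -> j != l ->
    forall v, v \in a i :: s i j -> v \notin a k :: s k l.
  rewrite neq_ltn => /orP[ik|ki] jl v vij; first exact: disj' vij.
  by apply: contraL vij => vkl; apply: disj' vkl; rewrite // eq_sym.
have arcs_far e : exists2 d : R, 0 < d & forall d', d' <= d ->
    let: (x, y, (u, v)) := e in G x y -> G u v ->
    x != u -> x != v -> y != u -> y != v ->
    forall s t : R, s \in `[0, 1] -> t \in `[0, 1] ->
    far_pt d' (arc x y s) (arc u v t).
  case: e => [[x y] [u v]].
  have [/andP[/andP[Gxy Guv] /and4P[xu xv yu yv]]|] :=
      boolP ((G x y && G u v) && [&& x != u, x != v, y != u & y != v]).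
    have [d d0 H] := disjoint_curves_apart (arc_continuous drawn Gxy)
      (arc_continuous drawn Guv)
      (fun s t => @arcs_disjoint _ _ _ _ _ drawn x y u v s t Gxy Guv xu xv yu yv).
    by exists d => // d' dd'; move: (H d' dd').
  by move=> no; exists 1 => // d' _ h1 h2 h3 h4 h5 h6; rewrite h1 h2 h3 h4 h5 h6 in no.
(* [d] is fixed before the sampling rate, which depends on it. *)
have [d d0 far] := uniform_positive arcs_far.
have steps e : exists N0 : nat, forall N, (N0 <= N)%N ->
    let: (x, y) := e in G x y ->
    forall s t : R, s \in `[0, 1] -> t \in `[0, 1] -> `|s - t| <= N.+1%:R^-1 ->
    near_pt d (arc x y s) (arc x y t).
  case: e => x y; have [Gxy|nG] := boolP (G x y); last by exists 0%N.
  have [N0 H] := curve_uniformly_continuous d0 (arc_continuous drawn Gxy).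
  by exists N0 => N N0N _; apply: H.
have [N near] := uniform_large steps.
have sn0 i j : s i j != [::].
  apply/eqP => sij; have ab : a i = b j by rewrite -(lasts i j) sij.
  have third (k : 'I_3) : exists k' : 'I_3, k' != k.
    by exists (if k == ord0 then ord_max else ord0); have [->|] := eqVneq k ord0; rewrite // eq_sym.
  have [k ki] := third i; have [l lj] := third j.
  have := disj i l k j; rewrite eq_sym ki lj => /(_ isT isT (a i) (mem_head _ _)).
  by rewrite ab -(lasts k j) mem_last.
apply: (@k33_obstruction R d (fun i => pt (a i)) (fun j => pt (b j))
  (fun i j => sample_walk arc N (a i) (s i j)) d0).
- by move=> i j; rewrite (last_sample_walk drawn N (paths i j)) lasts.
- move=> i j; elim: (s i j) (a i) (paths i j) => [//|y p IH] x /andP[Gxy Gp].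
  rewrite sample_walk_cons cat_path (path_sample_arc drawn Gxy (near (x, y) Gxy)).
  by rewrite (last_sample_arc drawn) // IH.
move=> i j k l ik jl p q pij qkl.
have [x [y [r [Gxy xp yp r01 ->]]]] := sample_walkP drawn (paths i j) (sn0 i j) pij.
have [u [v [t [Guv up vp t01 ->]]]] := sample_walkP drawn (paths k l) (sn0 k l) qkl.
have ne z w : z \in a i :: s i j -> w \in a k :: s k l -> z != w.
  by move=> hz hw; apply: contraTneq hw => <-; apply: disj hz.
exact: (far (x, y, (u, v)) Gxy Guv (ne _ _ xp up) (ne _ _ xp vp) (ne _ _ yp up) (ne _ _ yp vp)).
Qed.

End NoK33.

(** * Sides of a tree edge *)

From mathcomp Require Import all_boot zify.

Section Tree.
Variables (V : finType) (T : sgraph V).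
Hypothesis treeT : tree T.
Implicit Types (x y a b v w z : V).

Definition off_edge x y : rel V :=
  [rel a b | [&& T a b, (a, b) != (x, y) & (a, b) != (y, x)]].

(** For an edge xy of a tree, the component of [y] once this edge is removed. *)
Definition side x y : {set V} := [set v | connect (off_edge x y) y v].

Lemma mem_side x y : y \in side x y.
Proof. by rewrite inE connect0. Qed.

Lemma side_exit x y a b :
  T a b -> a \in side x y -> b \notin side x y -> a = y /\ b = x.
Proof.
rewrite !inE => Tab ya nyb.
have : ~~ off_edge x y a b.
  by apply: contra nyb => ab; apply: connect_trans ya (connect1 ab).
rewrite /off_edge /= Tab /= negb_and !negbK => /orP[] /eqP[ea eb] //.
by rewrite eb connect0 in nyb.
Qed.

Lemma side_irr x y : T x y -> x \notin side x y.
Proof.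
move=> Txy; apply/negP; rewrite inE => /connectP[p]; case/shortenP=> q pq /= uq _ lq.
have Tq : path T y q by apply: sub_path pq => a b /and3P[].
have /(_ (y :: q)) := treeT.2; rewrite /ucycle /= rcons_path Tq -lq Txy; case/andP: uq => -> -> /(_ isT).
case: q pq lq {Tq} => [|z [|//]] /= pq lq _.
  by rewrite lq adj_irrefl in Txy.
by move: pq; rewrite /off_edge /= -lq eqxx !andbF.
Qed.

Lemma side_ind x y (P : pred V) : P y ->
  (forall a b, a \in side x y -> b \in side x y -> T a b -> P a -> P b) ->
  forall v, v \in side x y -> P v.
Proof.
move=> Py step v; rewrite inE => /connectP[p].
elim/last_ind: p v => [v _ ->//|p z IH v].
rewrite rcons_path last_rcons => /andP[pp pz] ->.
have yl : connect (off_edge x y) y (last y p) by apply/connectP; exists p.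
apply: (step (last y p)); rewrite ?inE //.
- exact: connect_trans yl (connect1 pz).
- by case/and3P: pz.
exact: IH.
Qed.

Lemma tree_closed (A : {set V}) x : x \in A ->
  (forall a b, T a b -> a \in A -> b \in A) -> A = setT.
Proof.
move=> xA closed; apply/setP => v; rewrite inE.
have /connectP[p pp ->] := treeT.1.2 x v.
by elim: p x xA pp => //= z p IH x xA /andP[xz pz]; apply: IH pz; apply: closed xz _.
Qed.

Lemma sideC x y : T x y -> side y x = ~: side x y.
Proof.
move=> Txy.
have cutC a b : off_edge x y a b = off_edge x y b a.
  rewrite /off_edge /= adj_sym !xpair_eqE.
  by case: (T b a) => //=; rewrite ![(a == _) && _]andbC andbC.
have cutC' : off_edge y x =2 off_edge x y.
  by move=> a b; rewrite /off_edge /= [_ && ((a, b) != (x, y))]andbC.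
apply/setP => v; rewrite in_setC; apply/idP/idP => [vx|]; last first.
  suff: v \in side x y :|: side y x by rewrite in_setU => /orP[->|].
  rewrite (@tree_closed (side x y :|: side y x) y); first by rewrite inE.
    by rewrite in_setU mem_side.
  move=> a b Tab; rewrite !in_setU => aA.
  have [//|bx] := boolP (b \in side x y); have [//|by_] := boolP (b \in side y x).
  case/orP: aA => aA.
    by case: (side_exit Tab aA bx) => _ eb; rewrite eb mem_side in by_.
  by case: (side_exit Tab aA by_) => _ eb; rewrite eb mem_side in bx.
apply/negP => vy; case/negP: (side_irr Txy); move: vx vy; rewrite !inE.
rewrite (eq_connect cutC') => xv yv; apply: connect_trans yv _.
by rewrite (sym_connect_sym cutC).
Qed.

Lemma side_sub x y a : T x y -> T y a -> a != x -> side y a \subset side x y.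
Proof.
move=> Txy Tya ax; apply/subsetP; apply: side_ind => [|b b' bS b'S Tbb' bx].
  apply: contraNT ax => aS; apply/eqP.
  by case: (side_exit Tya (mem_side x y) aS).
apply: contraTT bS => b'x; case: (side_exit Tbb' bx b'x) => -> _.
exact: side_irr.
Qed.

Lemma side_disjoint y a b v : T y a -> T y b -> a != b ->
  v \in side y a -> v \notin side y b.
Proof.
move=> Tya Tyb ab va; have Tby : T b y by rewrite adj_sym.
by rewrite -in_setC -sideC // (subsetP (side_sub Tby Tya ab)).
Qed.

Lemma side_split x y v : T x y -> v \in side x y -> v != y ->
  exists a, [/\ T y a, a != x & v \in side y a].
Proof.
move=> Txy vS vy.
suff: (v == y) || [exists a, [&& T y a, a != x & v \in side y a]].
  rewrite (negbTE vy) => /existsP[a /and3P[? ? ?]]; by exists a.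
move: v vS {vy}; apply: side_ind => [|a b aS bS Tab]; first by rewrite eqxx.
have [//|nby /=] := eqVneq b y.
case/orP=> [/eqP ay|/existsP[e /and3P[Tye ex ae]]].
  apply/existsP; exists b; rewrite -ay Tab mem_side andbT /=.
  by apply/eqP => bx; rewrite bx (negbTE (side_irr Txy)) in bS.
apply/existsP; exists e; rewrite Tye ex /=.
by apply: contraNT nby => be; case: (side_exit Tab ae be) => _ ->.
Qed.

End Tree.

(** * Tree edges cut the outer cycle into arcs *)

Section Leaves.
Variables (V : finType) (T : sgraph V).
Implicit Types (x y a b l v w z : V).

Lemma leaf_nbr l a b : leaf T l -> T l a -> T l b -> a = b.
Proof.
rewrite /leaf /degree => /eqP/eqP/card1P[z Hz] la lb.
by move: (Hz a) (Hz b); rewrite !inE la lb => /esym/eqP-> /esym/eqP->.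
Qed.

(** A walk without repetitions does not pass through a leaf of the tree. *)
Lemma side_walk x y v : ~~ leaf T y -> v \in side T x y ->
  exists p, [/\ path T y p, last y p = v
    & forall z, z \in y :: p -> z \in side T x y /\ (leaf T z -> z = v)].
Proof.
move=> iy; rewrite inE => /connectP[p]; case/shortenP=> q pq uq _ ->.
have Tq : path T y q by apply: sub_path pq => a b /and3P[].
exists q; split=> // z zq; split.
  rewrite inE; apply/connectP; move: zq; rewrite inE => /orP[/eqP->|zq].
    by exists [::].
  case/path.splitP: zq pq {uq Tq} => q1 q2; rewrite cat_path => /andP[pq1 _].
  by exists (rcons q1 z); rewrite ?last_rcons.
move=> lz; move: zq; rewrite inE => /orP[/eqP zy|zq]; first by rewrite zy (negbTE iy) in lz.
case/path.splitP: zq Tq uq {pq} => q1 [|w q2] + uq; first by rewrite cats0 last_rcons.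
rewrite cat_path rcons_path last_rcons /= => /and3P[/andP[_ Tuz] Tzw _].
have uw : last y q1 = w by apply: (leaf_nbr lz) => //; rewrite adj_sym.
move: uq; rewrite -cat_cons cat_uniq => /and3P[_ /hasPn/(_ w (mem_head _ _))].
by rewrite -rcons_cons mem_rcons -uw mem_tail ?mem_last.
Qed.
End Leaves.

Section Planar.
Variables (R : realType) (V : finType) (G T : sgraph V) (c : seq V).
Hypotheses (treeT : tree T) (Uc : uniq c) (szc : 2 < size c).
Hypothesis memc : forall x, (x \in c) = leaf T x.
Hypothesis GE : forall x y, G x y = T x y || cycle_edge c x y.
Hypothesis planarG : planar R G.

(** A subdivided K33 with branch vertices [next c v], [next c w], [y] in one
    class and [v], [w], [x] in the other. The cycle gives two edges and the two
    walks from [next c v] to [w] and from [next c w] to [v], while the tree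
    gives the edge xy and, on its two sides, the walks from [x] or [y] to leaves. *)
Lemma exit_unique_internal x y v w : T x y -> ~~ leaf T x -> ~~ leaf T y ->
  v \in c -> v \in side T x y -> next c v \notin side T x y ->
  w \in c -> w \in side T x y -> next c w \notin side T x y -> v = w.
Proof.
move=> Txy ix iy vc vS nvS wc wS nwS; apply/eqP/negPn/negP => vw.
have nvw : next c v != next c w by apply: contraNneq vw => /(can_inj (prev_next Uc)) ->.
have [i p1 p2 _ _ rotc] : rot_to_arc_spec c (next c v) (next c w).
  by apply: rot_to_arc; rewrite ?mem_next.
have cycG z : z \in c -> G z (next c z).
  by move=> zc; rewrite GE /cycle_edge /= zc mem_next zc eqxx orbT.
have Gsym := adj_sym G.
have : fcycle (next c) (rot i c) by rewrite rot_cycle cycle_next.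
rewrite rotc /= rcons_cat rcons_cons cat_path /= rcons_path.
case/and4P=> f1 /eqP l1 f2 /eqP l2.
have {}l1 : last (next c v) p1 = w by apply: (can_inj (prev_next Uc)).
have {}l2 : last (next c w) p2 = v by apply: (can_inj (prev_next Uc)).
have Urot : uniq (next c v :: p1 ++ next c w :: p2) by rewrite -rotc rot_uniq.
have memrot z : z \in next c v :: p1 ++ next c w :: p2 -> z \in c by rewrite -rotc mem_rot.
have toG z p : (forall t, t \in z :: p -> t \in c) -> fpath (next c) z p -> path G z p.
  move=> pc; apply: (@sub_in_path _ (mem c)); last exact/allP.
  by move=> t t' tc _ /eqP<-; apply: cycG.
have {}f1 : path G (next c v) p1.
  by apply: toG f1 => t tp; apply: memrot; rewrite -cat_cons mem_cat tp.
have {}f2 : path G (next c w) p2.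
  by apply: toG f2 => t tp; apply: memrot; rewrite -cat_cons mem_cat tp orbT.
have TG z p : path T z p -> path G z p.
  by apply: sub_path => t t'; rewrite GE => ->.
have [q20 [/TG g20 l20 S20]] := side_walk iy vS.
have [q21 [/TG g21 l21 S21]] := side_walk iy wS.
have Tyx : T y x by rewrite adj_sym.
have SC z : z \in side T y x -> z \notin side T x y by rewrite (sideC treeT Txy) inE.
have outside z : z \notin side T x y ->
    exists p, [/\ path G z p, last z p = x & forall t, t \in z :: p ->
      t \notin side T x y /\ (leaf T t -> t = z)].
  rewrite -in_setC -(sideC treeT Txy) => /(side_walk ix)[p [/TG gp lp Sp]].
  have revp : rev (x :: p) = z :: rev (belast x p) by rewrite lastI rev_rcons lp.
  exists (rev (belast x p)); split=> [||t]; last first.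
  - by rewrite -revp mem_rev => /Sp[/SC].
  - by rewrite -[last _ _]/(last z (z :: _)) -revp rev_cons last_rcons.
  by rewrite -lp rev_path; apply: sub_path gp => t t'; rewrite Gsym.
have [q02 [g02 l02 S02]] := outside _ nvS.
have [q12 [g12 l12 S12]] := outside _ nwS.
pose a (i : 'I_3) := nth y [:: next c v; next c w; y] i.
pose b (i : 'I_3) := nth x [:: v; w; x] i.
pose s (i j : 'I_3) := nth [::] (nth [::] [:: [:: [:: v]; p1; q02];
  [:: p2; [:: w]; q12]; [:: q20; q21; [:: x]]] i) j.
have nvc : next c v \in c by rewrite mem_next.
have nwc : next c w \in c by rewrite mem_next.
have ne z t : z \in side T x y -> t \notin side T x y -> z != t.
  by move=> zS; apply: contraNneq => <-.
have leafne z t : z \in c -> ~~ leaf T t -> z != t.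
  by move=> zc; apply: contraNneq => <-; rewrite -memc.
apply: (@planar_no_k33 R V G a b s planarG).
- case=> [[|[|[|//]]] ?] [[|[|[|//]]] ?] //=; rewrite ?andbT //.
  + by rewrite Gsym cycG.
  + by rewrite Gsym cycG.
  + by rewrite GE Tyx.
- by case=> [[|[|[|//]]] ?] [[|[|[|//]]] ?] //=.
have arc1 t : t \in next c v :: p1 -> t \in c.
  by move=> tp; apply: memrot; rewrite -cat_cons mem_cat tp.
have arc2 t : t \in next c w :: p2 -> t \in c.
  by move=> tp; apply: memrot; rewrite -cat_cons mem_cat tp orbT.
have arc12 t : t \in next c v :: p1 -> t \notin next c w :: p2.
  move: Urot; rewrite -cat_cons cat_uniq => /and3P[_ /hasPn disj _].
  by apply: contraL => /disj.
have pair_c z t : z \in c -> t \in c -> forall r, r \in [:: z; t] -> r \in c.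
  by move=> zc tc r; rewrite !inE => /orP[] /eqP->.
have internal_off (p : seq V) : (forall t, t \in p -> t \in c) ->
    forall t, t \in p -> t \notin [:: y; x].
  by move=> pc t /pc tc; rewrite !inE negb_or !leafne.
have tree_off (p q : seq V) r : (forall t, t \in p -> t \in c) ->
    (forall t, t \in q -> leaf T t -> t = r) -> r \notin p ->
    forall t, t \in p -> t \notin q.
  move=> pc qr rp t tp; apply: contra rp => tq.
  by rewrite -(qr t tq) // -memc pc.
have sides_off (p q : seq V) : (forall t, t \in p -> t \notin side T x y) ->
    (forall t, t \in q -> t \in side T x y) ->
    forall t, t \in p -> t \notin q.
  by move=> pS qS t /pS tS; apply: contra tS => /qS.
have offC (p q : seq V) : (forall t, t \in p -> t \notin q) ->
    forall t, t \in q -> t \notin p.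
  by move=> pq t; apply: contraL => /pq.
have wA1 : w \in next c v :: p1 by rewrite -l1 mem_last.
have vA2 : v \in next c w :: p2 by rewrite -l2 mem_last.
have nwA1 : next c w \notin next c v :: p1 by apply: (offC _ _ arc12); apply: mem_head.
have nvA2 : next c v \notin next c w :: p2 by apply: arc12; apply: mem_head.
have vA1 : v \notin next c v :: p1 by apply: (offC _ _ arc12).
have wA2 : w \notin next c w :: p2 by apply: arc12.
have C00 := pair_c _ _ nvc vc; have C11 := pair_c _ _ nwc wc.
have v_nw := ne _ _ vS nwS; have w_nv := ne _ _ wS nvS.
have w00 : w \notin [:: next c v; v] by rewrite !inE negb_or w_nv eq_sym.
have nw00 : next c w \notin [:: next c v; v].
  by rewrite !inE negb_or ![next c w == _]eq_sym nvw.
have nv11 : next c v \notin [:: next c w; w].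
  by rewrite !inE negb_or nvw eq_sym.
have v11 : v \notin [:: next c w; w] by rewrite !inE negb_or v_nw.
have L02 t tq := (S02 t tq).2; have L12 t tq := (S12 t tq).2.
have L20 t tq := (S20 t tq).2; have L21 t tq := (S21 t tq).2.
have O02 t tq := (S02 t tq).1; have O12 t tq := (S12 t tq).1.
have I20 t tq := (S20 t tq).1; have I21 t tq := (S21 t tq).1.
case=> [[|[|[|//]]] ?] [[|[|[|//]]] ?] [[|[|[|//]]] ?] [[|[|[|//]]] ?] //= _ _;
  rewrite ?/a ?/s /=.
- by move=> t; rewrite !inE => /orP[] /eqP->; rewrite negb_or ?nvw ?v_nw // eq_sym.
- exact: (tree_off _ _ _ C00 L12 nw00).
- exact: (tree_off _ _ _ C00 L21 w00).
- exact: (internal_off _ C00).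
- exact: (tree_off _ _ _ arc1 L12 nwA1).
- exact: (tree_off _ _ _ arc1 L20 vA1).
- exact: (internal_off _ arc1).
- apply: offC; exact: (tree_off _ _ _ arc2 L02 nvA2).
- apply: offC; exact: (tree_off _ _ _ C11 L02 nv11).
- exact: (sides_off _ _ O02 I20).
- exact: (sides_off _ _ O02 I21).
- exact: (tree_off _ _ _ arc2 L21 wA2).
- exact: (internal_off _ arc2).
- exact: (tree_off _ _ _ C11 L20 v11).
- exact: (internal_off _ C11).
- exact: (sides_off _ _ O12 I20).
- exact: (sides_off _ _ O12 I21).
Qed.

(** When an end of the edge is a leaf, one of its two sides is a single leaf;
    otherwise planarity is needed. *)
Lemma exit_unique x y v w : T x y ->
  v \in c -> v \in side T x y -> next c v \notin side T x y ->
  w \in c -> w \in side T x y -> next c w \notin side T x y -> v = w.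
Proof.
move=> Txy vc vS nvS wc wS nwS.
have leaf_side x' y' : T x' y' -> leaf T y' -> forall z, z \in side T x' y' -> z = y'.
  move=> Txy' ly z zS; have [//|zy] := eqVneq z y'.
  have [a [Tya ax _]] := side_split treeT Txy' zS zy.
  by move: ax; rewrite (leaf_nbr ly Tya (b := x')) ?eqxx // adj_sym.
have [lx|ix] := boolP (leaf T x); last first.
  have [ly|iy] := boolP (leaf T y); last exact: (exit_unique_internal Txy).
  by rewrite (leaf_side _ _ Txy ly v) // (leaf_side _ _ Txy ly w).
have Tyx : T y x by rewrite adj_sym.
apply: (can_inj (prev_next Uc)).
have at_x z : z \notin side T x y -> z = x.
  by move=> zS; apply: (leaf_side y x Tyx lx); rewrite (sideC treeT Txy) in_setC.
by rewrite (at_x _ nvS) (at_x _ nwS).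
Qed.

End Planar.

(** * Leaves with adjacent parents *)

(** The combinatorial remains of a cubic Halin graph. Planarity survives in
    [frame_arc] only: the leaves beyond a tree edge are consecutive on [c]. By
    [frame_rot] and [frame_rev] the leaves can be numbered from any leaf and in
    either direction. *)
Record halin_frame (V : finType) (T : sgraph V) (c : seq V) : Prop :=
  HalinFrame {
  frame_tree : tree T;
  frame_uniq : uniq c;
  frame_size : 2 < size c;
  frame_leaf : forall x, (x \in c) = leaf T x;
  frame_degree : forall x, ~~ leaf T x -> degree T x = 3;
  frame_arc : forall x y v w, T x y ->
    v \in c -> v \in side T x y -> next c v \notin side T x y ->
    w \in c -> w \in side T x y -> next c w \notin side T x y -> v = w
}.

Section Cycle.
Variables (V : finType) (c : seq V).
Hypothesis Uc : uniq c.
Implicit Types a b v w : V.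

Lemma index_next v : v \in c ->
  index (next c v) c = if (index v c).+1 == size c then 0 else (index v c).+1.
Proof.
move=> vc; rewrite next_nth vc.
case: c Uc vc => // y p Up vp.
set i := index v (y :: p); have ip : i < size (y :: p) by rewrite index_mem.
case: eqP => [ei|/eqP ni].
  by rewrite nth_default ?index_head // -ltnS -[(size p).+1]/(size (y :: p)) -ei.
have ip' : i.+1 < size (y :: p) by rewrite ltn_neqAle ni.
by rewrite -[nth y p i]/(nth y (y :: p) i.+1) index_uniq.
Qed.

Lemma next_inj : injective (next c).
Proof. exact: can_inj (prev_next Uc). Qed.

Lemma next_neq v : 1 < size c -> v \in c -> next c v != v.
Proof.
move=> sc vc; apply/eqP => /(congr1 (index^~ c)); rewrite index_next //.
by move: sc; case: eqP; lia.
Qed.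

Lemma next2_neq v : 2 < size c -> v \in c -> next c (next c v) != v.
Proof.
move=> sc vc; apply/eqP => /(congr1 (index^~ c)).
rewrite index_next ?mem_next // index_next //.
by move: sc; do 2 case: eqP; lia.
Qed.

Lemma exists_exit (A : {pred V}) v w : v \in c -> v \in A -> w \in c -> w \notin A ->
  exists e, [/\ e \in c, e \in A & next c e \notin A].
Proof.
move=> vc vA wc wA.
have [/hasP[e ec /andP[eA neA]]|/hasPn closed] :=
  boolP (has (fun e => (e \in A) && (next c e \notin A)) c).
  by exists e.
case/negP: wA; have : fconnect (next c) v w.
  by rewrite (fconnect_cycle (cycle_next Uc)).
move/iter_findex <-; elim: (findex _ _ _) => //= k IH.
have kc : iter k (next c) v \in c by elim: k {IH} => //= k; rewrite mem_next.
by have := closed _ kc; rewrite IH /= negbK.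
Qed.
End Cycle.

Lemma frame_rev (V : finType) (T : sgraph V) (c : seq V) :
  halin_frame T c -> halin_frame T (rev c).
Proof.
case=> treeT Uc szc memc deg3 arcT.
split; rewrite ?rev_uniq ?size_rev //.
  by move=> x; rewrite mem_rev.
move=> x y v w Txy.
rewrite !mem_rev !(next_rev Uc) => vc vS nvS wc wS nwS.
have Tyx : T y x by rewrite adj_sym.
have SC z : (z \in side T y x) = (z \notin side T x y) by rewrite (sideC treeT Txy) inE.
apply: (can_inj (next_prev Uc)).
by apply: (arcT y x) => //; rewrite ?mem_prev ?SC ?(next_prev Uc) ?negbK.
Qed.

Lemma frame_rot (V : finType) (T : sgraph V) (c : seq V) i :
  halin_frame T c -> halin_frame T (rot i c).
Proof.
case=> treeT Uc szc memc deg3 arcT.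
split; rewrite ?rot_uniq ?size_rot //.
  by move=> x; rewrite mem_rot.
move=> x y v w Txy.
by rewrite !mem_rot !(next_rot _ Uc); apply: arcT.
Qed.

Section Frame.
Variables (V : finType) (T : sgraph V) (c : seq V).
Hypothesis F : halin_frame T c.
Implicit Types a b d e l p q u v w x y z : V.
Let treeT := frame_tree F.
Let Uc := frame_uniq F.
Let Tsym := adj_sym T.
Let sz1 : 1 < size c. Proof. exact: ltnW (frame_size F). Qed.

Definition parent l : V := odflt l [pick p | T l p].

Lemma parentP l : leaf T l -> T l (parent l).
Proof.
rewrite /parent => ll; case: pickP => //= no; move: ll.
by rewrite /leaf /degree (eq_card (B := pred0)) ?card0 // => x; rewrite inE no.
Qed.

Lemma parent_eq l p : leaf T l -> T l p -> p = parent l.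
Proof. by move=> ll lp; apply: (leaf_nbr ll) => //; apply: parentP. Qed.

Lemma parent_internal l : leaf T l -> ~~ leaf T (parent l).
Proof.
move=> ll; apply/negP => lp.
have A : [set l; parent l] = setT.
  apply: (tree_closed treeT (x := l)); first by rewrite !inE eqxx.
  move=> a b Tab; rewrite !inE => /orP[]/eqP ea; rewrite ea in Tab.
    by rewrite (parent_eq ll Tab) eqxx orbT.
  by rewrite (leaf_nbr lp Tab (b := l)) ?eqxx // Tsym parentP.
have := frame_size F; rewrite ltnNge => /negP[]; rewrite -(card_uniqP Uc).
apply: (@leq_trans #|[set l; parent l]|); last by rewrite cards2; case: (_ != _).
by apply: subset_leq_card; apply/subsetP => z _; rewrite A inE.
Qed.

Lemma leaf_adj l l' : leaf T l -> leaf T l' -> T l l' = false.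
Proof.
by move=> ll ll'; apply/negP => /(parent_eq ll) e; move: (parent_internal ll); rewrite -e ll'.
Qed.

Lemma internal_nbrs x a : ~~ leaf T x -> T x a ->
  exists b d, [/\ T x b, T x d, b != a, d != a & b != d] /\
    forall e, T x e -> [\/ e = a, e = b | e = d].
Proof.
move=> /(frame_degree F); rewrite /degree => d3 Txa.
have ax : a \in enum (T x) by rewrite mem_enum.
have [i s es] := rot_to ax.
have : size (rot i (enum (T x))) = 3 by rewrite size_rot -cardE -d3; apply: eq_card.
have Us : uniq (rot i (enum (T x))) by rewrite rot_uniq enum_uniq.
have Ms e : (e \in rot i (enum (T x))) = T x e by rewrite mem_rot mem_enum.
rewrite {}es in Us Ms *; case: s Us Ms => [|b [|d []]] // Us Ms _.
have Txb : T x b by rewrite -[T x b]Ms !inE eqxx orbT.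
have Txd : T x d by rewrite -[T x d]Ms !inE eqxx !orbT.
move: Us; rewrite /= !inE negb_or andbT => /andP[/andP[ab ad] bd].
exists b, d; split; first by split; rewrite // eq_sym.
move=> e Txe; have := Ms e; rewrite Txe !inE => /or3P[]/eqP->;
  by [constructor 1|constructor 2|constructor 3].
Qed.

Lemma third_nbr x a b : ~~ leaf T x -> T x a -> T x b -> a != b ->
  exists g, [/\ T x g, g != a, g != b & forall e, T x e -> [\/ e = a, e = b | e = g]].
Proof.
move=> ix Txa Txb ab.
have [e [d [[Txe Txd ea da ed] nbrs]]] := internal_nbrs ix Txa.
case: (nbrs _ Txb) => eb; first by rewrite eb eqxx in ab.
  by exists d; rewrite eb; split; rewrite // eq_sym.
exists e; rewrite eb; split=> // z /nbrs[]->; by [constructor 1|constructor 3|constructor 2].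
Qed.

Lemma leaf_side x y : T x y -> leaf T y -> forall z, z \in side T x y -> z = y.
Proof.
move=> Txy ly z zS; have [//|zy] := eqVneq z y.
have [a [Tya ax _]] := side_split treeT Txy zS zy.
by move: ax; rewrite (leaf_nbr ly Tya (b := x)) ?eqxx // Tsym.
Qed.

Lemma side_nbr x y a : T x y -> T y a -> a != x -> a \in side T x y.
Proof. by move=> Txy Tya ax; apply: (subsetP (side_sub treeT Txy Tya ax)); apply: mem_side. Qed.

Lemma enter_unique x y v w : T x y ->
  v \in c -> v \notin side T x y -> next c v \in side T x y ->
  w \in c -> w \notin side T x y -> next c w \in side T x y -> v = w.
Proof.
move=> Txy vc vS nvS wc wS nwS; have Tyx : T y x by rewrite Tsym.
by apply: (frame_arc F Tyx) => //; rewrite (sideC treeT Txy) in_setC ?negbK.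
Qed.

Lemma side_has_leaf x y : T x y -> exists2 v, leaf T v & v \in side T x y.
Proof.
have [n] := ubnP #|side T x y|; elim: n x y => // n IH x y le_n Txy.
have [ly|iy] := boolP (leaf T y); first by exists y => //; apply: mem_side.
have [b [d [[Tyb _ bx _ _] _]]] := internal_nbrs iy (a := x) (eq_trans (Tsym y x) Txy).
have sub := side_sub treeT Txy Tyb bx.
have /IH/(_ Tyb)[v lv vS] : #|side T y b| < n.
  rewrite -ltnS (leq_trans _ le_n) // ltnS proper_card //; apply/properP; split=> //.
  by exists y; rewrite ?mem_side ?(side_irr treeT).
by exists v => //; apply: (subsetP sub).
Qed.

Local Notation cadj := (cycle_edge c).

Lemma cadjC a b : cadj a b = cadj b a.
Proof. by rewrite /cycle_edge /= andbCA orbC. Qed.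

Lemma cadj_next a : a \in c -> cadj a (next c a).
Proof. by move=> ac; rewrite /cycle_edge /= ac mem_next ac eqxx. Qed.

Lemma cadj_prev a : a \in c -> cadj a (prev c a).
Proof. by move=> ac; rewrite cadjC -{2}[a](next_prev Uc) cadj_next ?mem_prev. Qed.

Lemma cadjP a b : cadj a b -> [/\ a \in c, b \in c & b = next c a \/ b = prev c a].
Proof.
case/and3P=> ac bc /orP[]/eqP e; split=> //; first by left.
by right; rewrite -e (prev_next Uc).
Qed.

(** Beyond the third edge at the common parent there are just these two leaves,
    and they are consecutive. *)
Lemma siblings_cadj l l' : leaf T l -> leaf T l' -> l != l' -> parent l = parent l' -> cadj l l'.
Proof.
move=> ll ll' ne enb; set p := parent l in enb *.
have Tpl : T p l by rewrite Tsym parentP.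
have Tpl' : T p l' by rewrite enb Tsym parentP.
have ip := parent_internal ll.
have [r [Tpr rl rl' nbrs_r]] := third_nbr ip Tpl Tpl' ne.
have Trp : T r p by rewrite Tsym.
have lc : l \in c by rewrite (frame_leaf F).
have l'c : l' \in c by rewrite (frame_leaf F).
have sideE z : leaf T z -> z \in side T r p -> z = l \/ z = l'.
  move=> lz zS; have zp : z != p by apply: contraTneq lz => ->.
  have [e [Tpe er ze]] := side_split treeT Trp zS zp.
  case: (nbrs_r _ Tpe) => ee; rewrite ee ?eqxx // in Tpe ze er.
    by left; apply: leaf_side ze.
  by right; apply: leaf_side ze.
have out v v' : leaf T v -> leaf T v' -> (forall z, leaf T z -> z \in side T r p -> z = v \/ z = v') ->
    ~~ cadj v v' -> next c v \notin side T r p.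
  move=> lv lv' vE nvv'; have vc : v \in c by rewrite (frame_leaf F).
  apply/negP => /vE[]; first by rewrite -(frame_leaf F) mem_next.
    by apply/eqP; apply: next_neq.
  by move=> e; rewrite -e cadj_next in nvv'.
apply/negPn/negP => no; case/eqP: ne.
apply: (frame_arc F Trp) => //; try (apply: side_nbr; by rewrite // eq_sym).
  exact: (out l l').
apply: (out l' l) => //; last by rewrite cadjC.
by move=> z lz /(sideE z lz)[]; [right|left].
Qed.

(** Two leaves [l] and [l'] have adjacent parents, and [Q] is the third branch
    at the parent of [l']. *)
Section TwoLeaves.
Variables l l' q : V.
Hypotheses (ll : leaf T l) (ll' : leaf T l') (pp' : T (parent l) (parent l')).
Hypothesis nadj : ~~ cadj l l'.
Hypotheses (p'q : T (parent l') q) (qp : q != parent l) (ql' : q != l').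
Let p := parent l.
Let p' := parent l'.
Let Q := side T p' q.
Let p'p : T p' p. Proof. by rewrite Tsym. Qed.
Let pl : T p l. Proof. by rewrite Tsym parentP. Qed.
Let p'l' : T p' l'. Proof. by rewrite Tsym parentP. Qed.
Let lc : l \in c. Proof. by rewrite (frame_leaf F). Qed.
Let l'c : l' \in c. Proof. by rewrite (frame_leaf F). Qed.
Let pl' : p != l'. Proof. by apply: contraTneq ll' => <-; apply: parent_internal. Qed.
Let p'l : p' != l. Proof. by apply: contraTneq ll => <-; apply: parent_internal. Qed.

Lemma between_notl : l \notin Q.
Proof.
apply: (side_disjoint treeT p'p p'q); first by rewrite eq_sym.
by apply: side_nbr; rewrite // eq_sym.
Qed.

Lemma between_notl' : l' \notin Q.
Proof. by apply: (side_disjoint treeT p'l' p'q); rewrite ?mem_side // eq_sym. Qed.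

Let in_A z : leaf T z -> z \in side T p p' -> z = l' \/ z \in Q.
Proof.
move=> lz zS; have zp' : z != p' by apply: contraTneq lz => ->; apply: parent_internal.
have [e [Tpe er ze]] := side_split treeT pp' zS zp'.
have [r [Tpr rp rl' nbrs]] := third_nbr (parent_internal ll') p'p p'l' pl'.
case: (nbrs _ Tpe) => ee; rewrite ee ?eqxx // in Tpe ze er.
  by left; apply: leaf_side ze.
by right; case: (nbrs _ p'q) => eq; move: qp ql'; rewrite ?eq ?eqxx // => _ _; rewrite /Q eq.
Qed.

Let A_l' : l' \in side T p p'.
Proof. by apply: side_nbr; rewrite // eq_sym. Qed.

Let A_Q z : z \in Q -> z \in side T p p'.
Proof. by apply: subsetP z; apply: side_sub. Qed.

Let nl' : next c l' != l'.
Proof. exact: next_neq. Qed.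

Let notA z : z \in c -> z \notin Q -> z != l' -> z \notin side T p p'.
Proof.
move=> zc zQ zl'; apply/negP => /in_A; rewrite -(frame_leaf F) => /(_ zc)[e|zQ'].
  by rewrite e eqxx in zl'.
by rewrite zQ' in zQ.
Qed.

(** The leaves of [Q] together with [l'] are the leaves beyond an edge, hence
    consecutive. If [Q] did not touch [l'], the cycle would leave this set both
    at [l'] and at the end of [Q]. *)
Lemma between_touch : prev c l' \in Q \/ next c l' \in Q.
Proof.
have [|n1] := boolP (next c l' \in Q); [by right|left].
have [v lv vQ] := side_has_leaf p'q.
have vc : v \in c by rewrite (frame_leaf F).
have [e [ec eQ neQ]] := exists_exit Uc vc vQ lc between_notl.
have [<-|nel'] := eqVneq (next c e) l'; first by rewrite (prev_next Uc).
have el' : e = l'.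
  by apply: (frame_arc F pp') => //; [apply: A_Q | apply: notA | apply: notA];
    rewrite ?mem_next.
by rewrite el' (negbTE between_notl') in eQ.
Qed.

(** [Q] has its last leaf before [l']. The leaves outside [Q] other than [l] and
    [l'] are those of the third branch at the parent of [l], so they form an arc
    too. If [next c l] were among them, this arc would be entered both after [l]
    and after [l']. Hence [Q] fills the cycle from [l] to [l']. *)
Lemma between_left : prev c l' \in Q ->
  [/\ next c l \in Q, next c l' \notin Q & prev c l \notin Q].
Proof.
move=> pQ; have pc : prev c l' \in c by rewrite mem_prev.
have exitQ e : e \in c -> e \in Q -> next c e \notin Q -> e = prev c l'.
  move=> ec eQ neQ; apply: (frame_arc F p'q) => //.
  by rewrite (next_prev Uc) between_notl'.
have n1 : next c l' \notin Q.
  apply/negP => nQ.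
  have l'A : l' \in [predU1 l' & Q] by rewrite !inE eqxx.
  have lA : l \notin [predU1 l' & Q].
    rewrite inE /= negb_or between_notl andbT.
    by apply: contraTneq pp' => ->; rewrite adj_irrefl.
  have [e [ec eA neA]] := exists_exit Uc l'c l'A lc lA.
  move: neA; rewrite inE /= negb_or => /andP[ne1 ne2].
  move: eA; rewrite inE /= => /orP[/eqP ee|eQ]; first by rewrite ee nQ in ne2.
  by case/eqP: ne1; rewrite (exitQ e) // (next_prev Uc).
have n2 : prev c l \notin Q.
  apply/negP => plQ; have : prev c l = prev c l'.
    by apply: exitQ; rewrite ?mem_prev // (next_prev Uc) between_notl.
  move/(can_inj (next_prev Uc)) => e; move: pp'.
  by rewrite e adj_irrefl.
split=> //; apply/negPn/negP => nlQ.
have [g [pg gp' gl nbrs]] := third_nbr (parent_internal ll) pp' pl p'l.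
have gp : T g p by rewrite Tsym.
have in_B z : z \in c -> z \notin Q -> z != l' -> z != l -> z \in side T p g.
  move=> zc zQ zl' zl; have := notA zc zQ zl'; rewrite -in_setC -(sideC treeT pp') => zB.
  have zp : z != p by apply: contraTneq zc => ->; rewrite (frame_leaf F) parent_internal.
  have [e [Tpe er ze]] := side_split treeT p'p zB zp.
  case: (nbrs _ Tpe) => ee; rewrite ee ?eqxx // in Tpe ze er.
  by move: zl; rewrite (leaf_side Tpe ll ze) eqxx.
have lG : l \notin side T p g.
  by apply: (side_disjoint treeT pl pg); rewrite ?mem_side // eq_sym.
have l'G : l' \notin side T p g.
  by apply: (side_disjoint treeT pp' pg _ A_l'); rewrite eq_sym.
have ll'ne : l != l' by apply: contraTneq pp' => ->; rewrite adj_irrefl.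
case/eqP: ll'ne; apply: (enter_unique pg) => //.
  apply: in_B; rewrite ?mem_next ?next_neq //.
  by apply: contraNneq nadj => <-; apply: cadj_next.
apply: in_B; rewrite ?mem_next //.
by apply: contraNneq nadj => <-; rewrite cadjC cadj_next.
Qed.

End TwoLeaves.

End Frame.

Lemma cycle_edge_rev (V : finType) (c : seq V) a b : uniq c ->
  cycle_edge (rev c) a b = cycle_edge c a b.
Proof.
move=> Uc; rewrite /cycle_edge /= !mem_rev !(next_rev Uc).
have [ac|] := boolP (a \in c) => //=; have [bc|] := boolP (b \in c) => //=.
have e u v : (prev c u == v) = (next c v == u).
  by apply/eqP/eqP => <-; rewrite ?(next_prev Uc) ?(prev_next Uc).
by rewrite !e orbC.
Qed.

Section Between.
Variables (V : finType) (T : sgraph V) (c : seq V).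
Hypothesis F : halin_frame T c.
Implicit Types a b d e g l p q u v w x y z : V.
Let treeT := frame_tree F.
Let Uc := frame_uniq F.
Let Tsym := adj_sym T.
Local Notation cadj := (cycle_edge c).
Local Notation parent := (parent T).

Variables l l' q : V.
Hypotheses (ll : leaf T l) (ll' : leaf T l') (pp' : T (parent l) (parent l')).
Hypothesis nadj : ~~ cadj l l'.
Hypotheses (p'q : T (parent l') q) (qp : q != parent l) (ql' : q != l').
Let Q := side T (parent l') q.
Let lc : l \in c. Proof. by rewrite (frame_leaf F). Qed.
Let l'c : l' \in c. Proof. by rewrite (frame_leaf F). Qed.

Lemma between :
  [/\ prev c l' \in Q, next c l \in Q, next c l' \notin Q & prev c l \notin Q] \/
  [/\ next c l' \in Q, prev c l \in Q, prev c l' \notin Q & next c l \notin Q].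
Proof.
have [pQ|nQ] := between_touch F ll ll' pp' p'q qp ql'.
  by left; have [] := between_left F ll ll' pp' nadj p'q qp ql' pQ.
right; have Fr := frame_rev F.
have nadjr : ~~ cycle_edge (rev c) l l' by rewrite cycle_edge_rev.
have [] := between_left Fr ll ll' pp' nadjr p'q qp ql'.
  by rewrite (prev_rev Uc).
by rewrite !(next_rev Uc) (prev_rev Uc).
Qed.

(** [Q] is an arc whose two outer neighbours are [l] and [l']. *)
Lemma between_exit a b : cadj a b -> a \in Q -> b \notin Q -> b = l \/ b = l'.
Proof.
have exitE e f : e \in c -> e \in Q -> next c e \notin Q -> f \in c -> f \in Q -> next c f \notin Q -> e = f.
  by move=> *; apply: (frame_arc F p'q).
have enterE e f : e \in c -> e \notin Q -> next c e \in Q -> f \in c -> f \notin Q -> next c f \in Q -> e = f.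
  by move=> *; apply: (enter_unique F p'q).
have lQ : l \notin Q by apply: (between_notl F).
have l'Q : l' \notin Q by apply: (between_notl' F).
move=> /(cadjP F)[ac bc [eb|eb]] aQ bQ.
  case: between => -[h1 h2 h3 h4].
    right; rewrite eb (exitE a (prev c l')) ?mem_prev ?(next_prev Uc) // -eb //.
  left; rewrite eb (exitE a (prev c l)) ?mem_prev ?(next_prev Uc) // -eb //.
have nb_a : next c b = a by rewrite eb (next_prev Uc).
case: between => -[h1 h2 h3 h4]; [left|right];
  by apply: enterE; rewrite ?nb_a.
Qed.

Lemma between_ends : (next c l' \in Q) (+) (prev c l' \in Q).
Proof. by case: between => -[h1 h2 h3 h4]; rewrite h1 (negbTE h3). Qed.

(** The other leaves of [Q] are those beyond a neighbour of [q], so they are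
    consecutive, and [z] can only be the first or the last leaf of the arc that
    [Q] fills between [l] and [l']. *)
Lemma outer_leaf z : leaf T z -> T q z -> cadj z l \/ cadj z l'.
Proof.
move=> lz qz; have zc : z \in c by rewrite (frame_leaf F).
have [zl|nzl] := boolP (cadj z l); [by left|right].
have [//|nzl'] := boolP (cadj z l').
have qp' : T q (parent l') by rewrite Tsym.
have iq : ~~ leaf T q by rewrite (parent_eq lz (p := q)) 1?Tsym // (parent_internal F).
have p'z : parent l' != z by apply: contraTneq lz => <-; apply: (parent_internal F).
have [r [qr rp' rz nbrs]] := third_nbr F iq qp' qz p'z.
have zQ : z \in Q by apply: (side_nbr F); rewrite // eq_sym.
have inQ v : cadj z v -> v \in Q.
  move=> zv; apply/negPn/negP => vQ; have [ev|ev] := between_exit zv zQ vQ.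
    by rewrite ev (negbTE nzl) in zv.
  by rewrite ev (negbTE nzl') in zv.
have inS v : v \in c -> v \in Q -> v != z -> v \in side T q r.
  move=> vc vQ vz; have vq : v != q.
    by apply: contraTneq vc => ->; rewrite (frame_leaf F).
  have [e [Tqe ep ve]] := side_split treeT p'q vQ vq.
  case: (nbrs _ Tqe) => ee; rewrite ee ?eqxx // in Tqe ve ep.
  by move: vz; rewrite (leaf_side F Tqe lz ve) eqxx.
have zS : z \notin side T q r.
  by apply: (side_disjoint treeT qz qr); rewrite ?mem_side // eq_sym.
have sz1 : 1 < size c by apply: ltnW (frame_size F).
have nzQ : next c z \in Q by apply/inQ/cadj_next.
have pzQ : prev c z \in Q by apply/inQ/(cadj_prev F).
have lQ : l \notin Q by apply: (between_notl F).
have [e [ec eQ neQ]] := exists_exit Uc zc zQ lc lQ.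
have ez : e != z by apply: contraNneq neQ => ->.
have neS : next c e \notin side T q r.
  apply: contra neQ; apply: subsetP; apply: (side_sub treeT) => //.
suff eE : e = prev c z by rewrite eE (next_prev Uc) zQ in neQ.
apply: (frame_arc F qr) => //; rewrite ?mem_prev ?(next_prev Uc) //.
  exact: inS.
apply: inS; rewrite ?mem_prev //.
apply/eqP => /(congr1 (next c)); rewrite (next_prev Uc) => zz.
by have := next_neq Uc sz1 zc; rewrite -zz eqxx.
Qed.

Lemma between_leaf : leaf T q -> cadj q l /\ cadj q l'.
Proof.
move=> lq; have qc : q \in c by rewrite (frame_leaf F).
have inQ v : v \in Q -> v = q by apply: (leaf_side F p'q lq).
case: between => -[/inQ h1 /inQ h2 _ _]; split; rewrite cadjC.
- by rewrite -h2 cadj_next.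
- by rewrite -h1 (cadj_prev F).
- by rewrite -h2 (cadj_prev F).
by rewrite -h1 cadj_next.
Qed.

End Between.

(** * From colour classes to packing colourings *)

(** Count modulo 2 the tree edges separating a vertex from a root. Two adjacent
    vertices are separated by their own edge and by no other. *)
Lemma tree_bipartite (V : finType) (T : sgraph V) : tree T ->
  exists chi : V -> bool, forall a b, T a b -> chi a = ~~ chi b.
Proof.
move=> treeT; have /card_gt0P[r _] := treeT.1.1.
pose P (e : V * V) := T e.1 e.2 && (r \notin side T e.1 e.2).
pose chi v := \big[addb/false]_(e | P e) (v \in side T e.1 e.2).
exists chi.
suff main a b : T a b -> r \notin side T a b -> chi a (+) chi b = true.
  move=> a b Tab; have [rS|rS] := boolP (r \in side T a b); last first.
    by have := main a b Tab rS; case: (chi a); case: (chi b).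
  have Tba : T b a by rewrite adj_sym.
  have /main : r \notin side T b a by rewrite (sideC treeT Tab) in_setC negbK.
  by move=> /(_ Tba); case: (chi a); case: (chi b).
move=> Tab rS; rewrite /chi -big_split /= (bigD1 (a, b)) /=; last by rewrite /P Tab.
rewrite mem_side (negbTE (side_irr treeT Tab)) big1 // => -[x y] /= /andP[/andP[/= Txy rxy] ne].
have [ax|ax] := boolP (a \in side T x y); have [bx|bx] := boolP (b \in side T x y) => //.
  have [ea eb] := side_exit Tab ax bx; subst a b.
  by move: rS; rewrite (sideC treeT Txy) in_setC rxy.
have [] := @side_exit _ T x y b a _ bx ax; first by rewrite adj_sym.
by move=> eb ea; rewrite ea eb eqxx in ne.
Qed.

Section Colouring.
Variables (V : finType) (G T : sgraph V) (c : seq V).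
Hypothesis F : halin_frame T c.
Hypothesis GE : forall x y, G x y = T x y || cycle_edge c x y.
Local Notation cadj := (cycle_edge c).

(** [X] is the set of deleted vertices and [M] consists of leaves whose parent is
    deleted, so that each [m] in [M] only keeps its two edges on the cycle. A
    2-colouring of the tree is correct away from the cycle; it has to be changed
    until [next c m] and [prev c m] agree, and [m] can then take the other
    colour. Exchanging the colours on [Q m] changes exactly one of these two
    neighbours, respects the tree edges that are left, and changes both
    or none of the neighbours of any other member of [M]. *)
Lemma two_coloring (X M : {set V}) (Q : V -> {set V}) :
  (forall a b m, T a b -> a \notin X -> b \notin X -> m \in M ->
     (a \in Q m) = (b \in Q m)) ->
  (forall a b, cadj a b -> a \notin X -> b \notin X -> a \in M \/ b \in M) ->
  (forall m b, m \in M -> T m b -> b \in X) ->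
  (forall m b, m \in M -> cadj m b -> b \notin M) ->
  (forall m, m \in M -> (next c m \in Q m) (+) (prev c m \in Q m)) ->
  (forall m m', m \in M -> m' \in M -> m != m' ->
     (next c m \in Q m') = (prev c m \in Q m')) ->
  exists chi : V -> bool,
    forall a b, a \notin X -> b \notin X -> G a b -> chi a != chi b.
Proof.
move=> treeQ coverM nbrM indM endM otherM.
have [chi0 chi0P] := tree_bipartite (frame_tree F).
(* [f m] tells whether [Q m] has to be recoloured. *)
pose f m := chi0 (next c m) (+) chi0 (prev c m).
pose psi v := chi0 v (+) \big[addb/false]_(m in M) (f m && (v \in Q m)).
have psi_ends m : m \in M -> psi (next c m) = psi (prev c m).
  move=> mM; rewrite /psi !(bigD1 m mM) /=.
  rewrite (eq_bigr (fun m' => f m' && (prev c m \in Q m'))); last first.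
    by move=> m' /andP[m'M m'm]; rewrite (otherM m m') // eq_sym.
  move: (endM m mM); rewrite {1 3}/f.
  by case: (chi0 _); case: (chi0 _); case: (_ \in Q m); case: (_ \in Q m); case: (\big[_/_]_(_ in M | _) _).
pose chi v := if v \in M then ~~ psi (next c v) else psi v.
have chi_cycle a b : a \in M -> cadj a b -> chi a != chi b.
  move=> aM ab; rewrite /chi aM (negbTE (indM _ _ aM ab)).
  case/(cadjP F): ab => _ _ [->|->]; last rewrite -psi_ends //; by case: (psi _).
exists chi => a b aX bX; rewrite GE => /orP[Tab|ab]; last first.
  case: (coverM a b ab aX bX) => [aM|bM]; first exact: chi_cycle.
  by rewrite eq_sym chi_cycle // cadjC.
have aM : a \notin M by apply: contra bX => /nbrM; apply.
have bM : b \notin M by apply: contra aX => /nbrM; apply; rewrite adj_sym.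
rewrite /chi (negbTE aM) (negbTE bM) /psi (chi0P a b Tab).
rewrite (eq_bigr (fun m => f m && (b \in Q m))); last first.
  by move=> m mM; rewrite (treeQ a b m).
by case: (chi0 b); case: (\big[_/_]_(_ in M) _).
Qed.
End Colouring.

Lemma dist_geP (V : finType) (G : sgraph V) u v m :
  (forall d, d < m -> ~~ walk G u v d) -> dist_ge (dist G u v) m.
Proof.
move=> far; rewrite /dist_ge; have := distP G u v.
case: (dist G u v) => // d [wd _]; rewrite leqNgt; apply/negP => /far.
by rewrite wd.
Qed.

Lemma packing_of_classes (V : finType) (G : sgraph V) (P2 P3 : {set V})
    (chi : V -> bool) :
  (forall a b, a \notin P2 :|: P3 -> b \notin P2 :|: P3 -> G a b -> chi a != chi b) ->
  (forall v, v \in P2 -> v \notin P3) ->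
  (forall u v, u \in P2 -> v \in P2 -> u != v ->
     ~~ G u v /\ forall m, G u m -> ~~ G m v) ->
  (forall u v, u \in P3 -> v \in P3 -> u != v ->
     [/\ ~~ G u v, forall m, G u m -> ~~ G m v
       & forall m m', G u m -> G m m' -> ~~ G m' v]) ->
  packing_colorable [:: 1; 1; 2; 3] G.
Proof.
move=> chiP disj far2 far3.
pose Q (i : nat) := if i is 0 then [set v | v \notin P2 :|: P3 & chi v]
  else if i is 1 then [set v | v \notin P2 :|: P3 & ~~ chi v]
  else if i is 2 then P2 else P3.
exists (fun i : 'I_4 => Q i); split=> [x|].
  have [x2|x2] := boolP (x \in P2).
    exists (@Ordinal 4 2 isT); split=> // -[[|[|[|[|//]]]] ?] /=; rewrite ?inE ?x2 ?(negbTE (disj _ x2)) // => _.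
    exact: val_inj.
  have [x3|x3] := boolP (x \in P3).
    exists (@Ordinal 4 3 isT); split=> // -[[|[|[|[|//]]]] ?] /=; rewrite ?inE ?x3 ?(negbTE x2) ?orbT // => _.
    exact: val_inj.
  exists (if chi x then @Ordinal 4 0 isT else @Ordinal 4 1 isT).
  split; first by case: ifP => e /=; rewrite !inE e (negbTE x2) (negbTE x3).
  by case=> [[|[|[|[|//]]]] ?] /=; rewrite ?inE ?(negbTE x2) ?(negbTE x3) //= => e;
    apply: val_inj; rewrite ?e ?(negbTE e).
have walk0 u v : u != v -> ~~ walk G u v 0.
  by move=> uv; apply/walkP => -[[|a p] [_ /= e //]]; rewrite e eqxx in uv.
have walk1 u v : ~~ G u v -> ~~ walk G u v 1.
  move=> uv; apply/walkP => -[[|a [|a' p]] [/=]] // /andP[ua _] e _.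
  by rewrite -e ua in uv.
have walk2 u v : (forall m, G u m -> ~~ G m v) -> ~~ walk G u v 2.
  move=> uv; apply/walkP => -[[|a [|b [|b' p]]] [/=]] // /and3P[ua ab _] e _.
  by move: (uv a ua); rewrite -e ab.
have walk3 u v : (forall m m', G u m -> G m m' -> ~~ G m' v) -> ~~ walk G u v 3.
  move=> uv; apply/walkP => -[[|a [|b [|d [|d' p]]]] [/=]] // /and4P[ua ab bd _] e _.
  by move: (uv a b ua ab); rewrite -e bd.
case=> [[|[|[|[|//]]]] ?] u v /= uP vP uv; apply: dist_geP.
- move: uP vP; rewrite !inE => /andP[uX cu] /andP[vX cv].
  case=> [|[|//]] _; [exact: walk0 | apply: walk1; apply/negP => Guv].
  by have := chiP u v; rewrite !inE cu cv => /(_ uX vX Guv).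
- move: uP vP; rewrite !inE => /andP[uX cu] /andP[vX cv].
  case=> [|[|//]] _; [exact: walk0 | apply: walk1; apply/negP => Guv].
  by have := chiP u v; rewrite !inE (negbTE cu) (negbTE cv) => /(_ uX vX Guv).
- have [h1 h2] := far2 u v uP vP uv.
  by case=> [|[|[|//]]] _; [exact: walk0 | exact: walk1 | exact: walk2].
have [h1 h2 h3] := far3 u v uP vP uv.
by case=> [|[|[|[|//]]]] _; [exact: walk0 | exact: walk1 | exact: walk2 | exact: walk3].
Qed.

(** * Repairing conflicts between marked leaves *)

Section Repair.
Variables (V : finType) (G T : sgraph V) (c : seq V).
Hypothesis F : halin_frame T c.
Hypothesis GE : forall x y, G x y = T x y || cycle_edge c x y.
Implicit Types a b d e g l m p q u v w x y z : V.
Let treeT := frame_tree F.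
Let Uc := frame_uniq F.
Let Tsym := adj_sym T.
Let Gsym := adj_sym G.
Local Notation cadj := (cycle_edge c).
Local Notation parent := (parent T).

Lemma adj_internal m v : ~~ leaf T m -> G m v -> T m v.
Proof.
by rewrite GE -(frame_leaf F) => mc /orP[//|/(cadjP F)[mc' _ _]]; rewrite mc' in mc.
Qed.

Lemma adj_leaf v m : leaf T v -> G v m -> m = parent v \/ cadj v m.
Proof. by move=> lv; rewrite GE => /orP[/(parent_eq lv)|]; [left|right]. Qed.

Lemma cadj_leaf a b : cadj a b -> leaf T a /\ leaf T b.
Proof. by case/(cadjP F) => ac bc _; rewrite -!(frame_leaf F). Qed.

Lemma leaf_walk2 u v m : leaf T u -> leaf T v -> u != v -> G u m -> G m v ->
  cadj u v \/ cadj u m /\ cadj m v.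
Proof.
move=> lu lv uv /(adj_leaf lu)[->|um] mv.
  have Tv : T (parent u) v by apply: adj_internal mv; apply: (parent_internal F).
  left; apply: (siblings_cadj F) => //.
  by apply: (parent_eq lv); rewrite Tsym.
right; split=> //; have [_ lm] := cadj_leaf um.
move: mv; rewrite GE => /orP[Tmv|//].
by rewrite (leaf_adj F lm lv) in Tmv.
Qed.

(** Where the walk goes up to a parent and down again at once, it joins siblings,
    which are neighbours on the cycle. Apart from this, a walk of length 3 has
    time to leave the cycle only through both parents. *)
Lemma leaf_walk3 u v m m' : leaf T u -> leaf T v -> u != v ->
  G u m -> G m m' -> G m' v ->
  [\/ cadj u v, exists2 z, cadj u z & cadj z v,
      [/\ cadj u m, cadj m m' & cadj m' v] | T (parent u) (parent v)].
Proof.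
move=> lu lv uv um mm' m'v; case/(adj_leaf lu): um => [em|um].
  have Tm' : T (parent u) m' by rewrite -em; apply: adj_internal mm'; rewrite em (parent_internal F).
  rewrite Gsym in m'v; case/(adj_leaf lv): m'v => [em'|vm'].
    by constructor 4; rewrite -em'.
  have [_ lm'] := cadj_leaf vm'; rewrite cadjC in vm'.
  have [eu|um'] := eqVneq u m'; first by constructor 1; rewrite eu.
  constructor 2; exists m' => //; apply: (siblings_cadj F) => //.
  by apply: (parent_eq lm'); rewrite Tsym.
have [_ lm] := cadj_leaf um.
have [ev|mv] := eqVneq m v; first by constructor 1; rewrite -ev.
have [mv'|[h1 h2]] := leaf_walk2 lm lv mv mm' m'v.
  by constructor 2; exists m.
by constructor 3.
Qed.

(** The leaves marked 2 and 3 are spread well along the cycle; the vertex [r]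
    serves to orient the edges of the tree. *)
Variables (X2 X3 : {set V}) (r : V).
Let X := X2 :|: X3.
Hypothesis leafX : forall v, v \in X -> leaf T v.
Hypothesis disjX : forall v, v \in X2 -> v \notin X3.
Hypothesis indX : forall a b, cadj a b -> a \in X -> b \notin X.
Hypothesis gap2 : forall a m b, cadj a m -> cadj m b -> a != b ->
  (a \in X2 -> b \notin X2) /\ (a \in X3 -> b \notin X3).
Hypothesis gap3 : forall a m m' b, cadj a m -> cadj m m' -> cadj m' b -> a != b ->
  a \in X3 -> b \notin X3.

Let X3X v : v \in X3 -> v \in X. Proof. by rewrite inE orbC => ->. Qed.
Let X2X v : v \in X2 -> v \in X. Proof. by rewrite inE => ->. Qed.
Let leaf2 v : v \in X2 -> leaf T v. Proof. by move/X2X/leafX. Qed.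
Let leaf3 v : v \in X3 -> leaf T v. Proof. by move/X3X/leafX. Qed.

(** Two leaves marked 3 at distance 3 through their parents, [a] being the upper
    one, on the way to [r]. *)
Definition conflict a b :=
  [&& a \in X3, b \in X3, T (parent a) (parent b) & r \in side T (parent b) (parent a)].

(** The lower leaf of a conflict gives up its mark, and its parent takes the
    colour 2 instead. *)
Definition moved : {set V} := [set b | [exists a, conflict a b]].

Definition hub : {set V} := [set parent b | b in moved].

(** The third neighbour of the parent of [b], besides [b] and the one towards [r]. *)
Definition branch_root b :=
  odflt b [pick q | [&& T (parent b) q, r \notin side T (parent b) q & q != b]].

Definition branch b := side T (parent b) (branch_root b).

Lemma movedP b : reflect (exists a, conflict a b) (b \in moved).
Proof. by rewrite inE; apply: existsP. Qed.

Lemma moved3 b : b \in moved -> b \in X3.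
Proof. by case/movedP => a /and4P[]. Qed.

(** If [q] were a leaf, it would be next to both [a] and [b], which are marked
    alike. A leaf hanging from [q] is next to [a] or to [b], and neighbours of
    marked leaves are unmarked. *)
Lemma third_internal a b q : a \in X3 -> b \in X3 -> T (parent a) (parent b) ->
  T (parent b) q -> q != parent a -> q != b ->
  ~~ leaf T q /\ forall z, T q z -> z \notin X.
Proof.
move=> a3 b3 ab bq qa qb; have la := leaf3 a3; have lb := leaf3 b3.
have nadj : ~~ cadj a b by apply: contraTN (X3X b3) => /indX; apply; apply: X3X.
have neab : a != b by apply: contraTneq ab => ->; rewrite adj_irrefl.
split; last first.
  move=> z qz; have [lz|] := boolP (leaf T z); last by apply: contra => /leafX.
  have [za|zb] := outer_leaf F la lb ab nadj bq qa qb lz qz.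
    by apply: contraL (X3X a3); apply: indX.
  by apply: contraL (X3X b3); apply: indX.
apply/negP => lq; have [qa' qb'] := between_leaf F la lb ab nadj bq qa qb lq.
rewrite cadjC in qa'; have [_ /(_ a3)] := gap2 qa' qb' neab.
by rewrite b3.
Qed.

Lemma branchP a b : conflict a b -> let q := branch_root b in
  [/\ T (parent b) q, q != parent a, q != b
    & forall e, T (parent b) e -> [\/ e = parent a, e = b | e = q]].
Proof.
case/and4P => a3 b3 ab rS; have la := leaf3 a3; have lb := leaf3 b3.
have ba : T (parent b) (parent a) by rewrite Tsym.
have bb : T (parent b) b by rewrite Tsym parentP.
have ab' : parent a != b by apply: contraTneq lb => <-; apply: (parent_internal F).
have [q [bq qa qb nbrs]] := third_nbr F (parent_internal F lb) ba bb ab'.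
suff -> : branch_root b = q by [].
rewrite /branch_root; case: pickP => [z /and3P[bz rz zb]|/(_ q)]; last first.
  by rewrite bq qb (side_disjoint treeT ba bq _ rS) // eq_sym.
case: (nbrs z bz) => ez; rewrite ez // in rz zb *.
  by rewrite rS in rz.
by rewrite eqxx in zb.
Qed.

(** Otherwise the parent of [a] would have a neighbour with a marked leaf besides
    the parent of [b], against [third_internal]. *)
Lemma conflict_unmoved a b : conflict a b -> a \notin moved.
Proof.
case/and4P => a3 b3 ab rS; apply/movedP => -[a' /and4P[a'3 _ a'a rS']].
have ba : T (parent b) (parent a) by rewrite Tsym.
have aa' : T (parent a) (parent a') by rewrite Tsym.
have ne : parent a' != parent b.
  by apply: contraTneq rS' => ->; rewrite (sideC treeT ba) in_setC rS.
have ne' : parent a' != a by apply: contraTneq (leaf3 a3) => <-; rewrite (parent_internal F) ?leaf3.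
have [_ /(_ a')] := third_internal b3 a3 ba aa' ne ne'.
by rewrite Tsym parentP ?leaf3 // X3X // => /(_ isT).
Qed.

(** With [lower_nbrs], this says that the marked leaves other than [a] and [b]
    stay away from a conflict. *)
Lemma upper_nbrs a b : conflict a b -> forall e, T (parent a) e ->
  [\/ e = parent b, e = a | ~~ leaf T e /\ forall z, T e z -> z \notin X].
Proof.
case/and4P => a3 b3 ab _ e ae; have ba : T (parent b) (parent a) by rewrite Tsym.
have [->|eb] := eqVneq e (parent b); first by constructor 1.
have [->|ea] := eqVneq e a; first by constructor 2.
by constructor 3; apply: third_internal ae eb ea.
Qed.

Lemma lower_nbrs a b : conflict a b -> forall e, T (parent b) e ->
  [\/ e = parent a, e = b | e = branch_root b /\ ~~ leaf T e /\ forall z, T e z -> z \notin X].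
Proof.
move=> ab e be; case: (branchP ab) => bq qa qb nbrs; case/and4P: (ab) => a3 b3 Tab _.
case: (nbrs e be) => ->; [by constructor 1|by constructor 2|constructor 3; split=> //].
exact: (third_internal a3 b3 Tab bq qa qb).
Qed.

Lemma unmoved_free a b : a \in X3 -> b \in X3 -> a \notin moved -> b \notin moved ->
  ~~ T (parent a) (parent b).
Proof.
move=> a3 b3 aM bM; apply/negP => ab; have ba : T (parent b) (parent a) by rewrite Tsym.
have [rS|rS] := boolP (r \in side T (parent b) (parent a)).
  by case/movedP: bM; exists a; apply/and4P.
by case/movedP: aM; exists b; apply/and4P; rewrite (sideC treeT ba) in_setC.
Qed.

(** Two unmoved leaves have no adjacent parents, for otherwise one of them would
    be the lower one; the other short walks stay on the cycle. *)
Lemma far_X3 u v : u \in X3 :\: moved -> v \in X3 :\: moved -> u != v ->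
  [/\ ~~ G u v, forall m, G u m -> ~~ G m v
    & forall m m', G u m -> G m m' -> ~~ G m' v].
Proof.
rewrite !in_setD => /andP[uM u3] /andP[vM v3] uv.
have lu := leaf3 u3; have lv := leaf3 v3.
have nadj : ~~ cadj u v by apply: contraTN (X3X v3) => /indX; apply; apply: X3X.
have nadj2 m : cadj u m -> cadj m v -> False.
  by move=> um mv; have [_ /(_ u3)] := gap2 um mv uv; rewrite v3.
split.
- by rewrite GE (leaf_adj F lu lv).
- move=> m um; apply/negP => mv.
  by have [h|[]] := leaf_walk2 lu lv uv um mv; [rewrite h in nadj | apply: nadj2].
move=> m m' um mm'; apply/negP => m'v.
have [h|[z]|[h1 h2 h3]|h] := leaf_walk3 lu lv uv um mm' m'v.
- by rewrite h in nadj.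
- exact: nadj2.
- by have := gap3 h1 h2 h3 uv u3; rewrite v3.
by have := unmoved_free u3 v3 uM vM; rewrite h.
Qed.

Lemma far_X2 u v : u \in X2 -> v \in X2 -> u != v ->
  ~~ G u v /\ forall m, G u m -> ~~ G m v.
Proof.
move=> u2 v2 uv; have lu := leaf2 u2; have lv := leaf2 v2.
have nadj : ~~ cadj u v by apply: contraTN (X2X v2) => /indX; apply; apply: X2X.
split; first by rewrite GE (leaf_adj F lu lv).
move=> m um; apply/negP => mv.
have [h|[h1 h2]] := leaf_walk2 lu lv uv um mv; first by rewrite h in nadj.
by have [/(_ u2)] := gap2 h1 h2 uv; rewrite v2.
Qed.

Lemma hub_internal p : p \in hub -> ~~ leaf T p.
Proof. by case/imsetP => b /moved3/leaf3 lb ->; apply: (parent_internal F). Qed.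

Lemma far_hub_X2 p v : p \in hub -> v \in X2 ->
  ~~ G p v /\ forall m, G p m -> ~~ G m v.
Proof.
case/imsetP => b bM -> v2; have lv := leaf2 v2; have vX := X2X v2.
have b3 := moved3 bM; have lb := leaf3 b3; have [a ab] := movedP _ bM.
have ib := parent_internal F lb; have /and4P[a3 _ Tab _] := ab; have la := leaf3 a3.
have ia := parent_internal F la.
have v3 := disjX v2.
split.
  apply/negP => /(adj_internal ib)/(lower_nbrs ab)[e|e|[_ [] ]].
  - by rewrite -e lv in ia.
  - by rewrite e b3 in v3.
  by rewrite lv.
move=> m bm; apply/negP => mv.
case: (lower_nbrs ab (adj_internal ib bm)) => [em|em|[_ [im mX]]].
- rewrite em in mv; case: (upper_nbrs ab (adj_internal ia mv)) => [e|e|[]].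
  + by rewrite -e lv in ib.
  + by rewrite e a3 in v3.
  by rewrite lv.
- rewrite em in mv; case: (adj_leaf lb mv) => [e|bv].
    by rewrite -e lv in ib.
  by have := indX bv (X3X b3); rewrite vX.
by have := mX v (adj_internal im mv); rewrite vX.
Qed.

Lemma far_hub p p2 : p \in hub -> p2 \in hub -> p != p2 ->
  ~~ G p p2 /\ forall m, G p m -> ~~ G m p2.
Proof.
case/imsetP => b bM -> /imsetP[b2 b2M ->] ne.
have b3 := moved3 bM; have lb := leaf3 b3; have [a ab] := movedP _ bM.
have b23 := moved3 b2M; have lb2 := leaf3 b23; have b2X := X3X b23.
have ib := parent_internal F lb; have /and4P[a3 _ Tab rS] := ab; have la := leaf3 a3.
have ia := parent_internal F la; have ib2 := parent_internal F lb2.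
have Tb2 : T (parent b2) b2 by rewrite Tsym parentP.
split.
  apply/negP => /(adj_internal ib)/(lower_nbrs ab)[e|e|[_ [_ /(_ b2 Tb2)]]].
  - rewrite e in Tb2; case: (upper_nbrs ab Tb2) => [e'|e'|[]].
    + by rewrite e' (negbTE ib) in lb2.
    + by have := conflict_unmoved ab; rewrite -e' b2M.
    by rewrite lb2.
  - by rewrite e lb in ib2.
  by rewrite b2X.
move=> m bm; apply/negP => mb2.
case: (lower_nbrs ab (adj_internal ib bm)) => [em|em|[em [im mX]]].
- rewrite em in mb2; case: (upper_nbrs ab (adj_internal ia mb2)) => [e|e|[_ /(_ b2 Tb2)]].
  + by rewrite e eqxx in ne.
  + by rewrite e la in ib2.
  by rewrite b2X.
- rewrite em in mb2; case: (adj_leaf lb mb2) => [e|/cadj_leaf[_]].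
    by rewrite e eqxx in ne.
  by rewrite (negbTE ib2).
have Tmb2 := adj_internal im mb2; have Tbm := adj_internal ib bm.
have [a2 /and4P[a23 _ Tab2 rS2]] := movedP _ b2M.
have [ea2|na2] := eqVneq (parent a2) m.
  by have := mX a2; rewrite -ea2 Tsym parentP ?leaf3 // X3X // => /(_ isT).
have Tb2m : T (parent b2) m by rewrite Tsym.
have Tmb : T m (parent b) by rewrite Tsym.
have Tba2 : T (parent b2) (parent a2) by rewrite Tsym.
have Tba : T (parent b) (parent a) by rewrite Tsym.
(* Seen from the second hub, [r] lies beyond [parent a2], but also beyond [m],
   behind the first hub. *)
have am : parent a != m.
  by case: (branchP ab) => _ qa _ _; rewrite em eq_sym.
have r1 : r \in side T m (parent b) by apply: subsetP rS; apply: side_sub.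
have r2 : r \in side T (parent b2) m by apply: subsetP r1; apply: side_sub.
by have := side_disjoint treeT Tba2 Tb2m na2 rS2; rewrite r2.
Qed.

(** Besides the marked leaves, at most one vertex in [U2] gets the colour 2 and at
    most one in [U3] the colour 3. The set [O] is empty or consists of one
    unmarked leaf whose parent, shared with the next leaf, is of this kind. Like
    the moved leaves, this leaf keeps only its edges on the cycle. *)
Variables (O U2 U3 : {set V}).
Hypothesis leafO : forall o, o \in O -> leaf T o.
Hypothesis O_X : forall o, o \in O -> o \notin X.
Hypothesis O_nb : forall o, o \in O -> parent o \in U2 :|: U3.
Hypothesis O_next : forall o, o \in O -> parent (next c o) = parent o.
Hypothesis O_uniq : forall o o', o \in O -> o' \in O -> o = o'.
Hypothesis O_free : forall o z a, o \in O -> cadj o z -> z \in X3 -> a \in X3 ->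
  ~~ T (parent z) (parent a).
Hypothesis O_next2 : forall o, o \in O -> next c (next c o) \notin moved.
Hypothesis cover : forall a b, cadj a b -> [\/ a \in X, b \in X, a \in O | b \in O].
Hypothesis U2_internal : forall u, u \in U2 -> ~~ leaf T u.
Hypothesis U3_internal : forall u, u \in U3 -> ~~ leaf T u.
Hypothesis U2_uniq : forall u u', u \in U2 -> u' \in U2 -> u = u'.
Hypothesis U3_uniq : forall u u', u \in U3 -> u' \in U3 -> u = u'.
Hypothesis U23 : forall u, u \in U2 -> u \notin U3.
Hypothesis U3_hub : forall u, u \in U3 -> u \notin hub.
Hypothesis U2_far : forall u v, u \in U2 -> v \in X2 :|: hub ->
  ~~ G u v /\ forall m, G u m -> ~~ G m v.
Hypothesis U3_far : forall u v, u \in U3 -> v \in X3 :\: moved ->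
  [/\ ~~ G u v, forall m, G u m -> ~~ G m v
    & forall m m', G u m -> G m m' -> ~~ G m' v].

Let P2 := X2 :|: hub :|: U2.
Let P3 := (X3 :\: moved) :|: U3.
(* For the leaf in [O], the next leaf has lost its parent too and can be recoloured
   alone. *)
Let Q b := if b \in moved then branch b else [set next c b].

Let deleted v : v \in X -> v \notin moved -> v \in P2 :|: P3.
Proof.
by rewrite /P2 /P3 !inE => /orP[->|->] // ->; rewrite !orbT.
Qed.

Lemma branch_cross m a b : m \in moved -> cadj a b ->
  a \in branch m -> b \notin branch m ->
  exists2 l, conflict l m & b = l \/ b = m.
Proof.
case/movedP => l lm ab aQ bQ; exists l => //.
have [mq ql qm _] := branchP lm; have /and4P[l3 m3 Tlm _] := lm.
have nadj : ~~ cadj l m by apply: contraTN (X3X m3) => /indX; apply; apply: X3X.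
exact: (between_exit F (leaf3 l3) (leaf3 m3) Tlm nadj mq ql qm ab aQ bQ).
Qed.

(** Each remaining edge of the cycle meets a moved leaf or the leaf in [O]. A
    branch is joined to the rest of the tree through a hub, and along the cycle
    through the two leaves of its conflict; one of these is moved and the other
    is deleted, so the colours of the branch can be chosen freely. *)
Lemma forest_colouring : exists chi : V -> bool,
  forall a b, a \notin P2 :|: P3 -> b \notin P2 :|: P3 -> G a b -> chi a != chi b.
Proof.
have O_moved o : o \in O -> o \notin moved.
  by move=> oO; apply: contra (O_X oO) => /moved3/X3X.
have hub_deleted b : b \in moved -> parent b \in P2 :|: P3.
  by move=> bM; rewrite !in_setU (imset_f parent bM) orbT.
have O_deleted o : o \in O -> parent o \in P2 :|: P3.
  by move/O_nb; rewrite !in_setU => /orP[]->; rewrite ?orbT.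
have O_nbr_unmoved o z : o \in O -> cadj o z -> z \notin moved.
  move=> oO oz; apply/negP => zM; have [a az] := movedP _ zM.
  have /and4P[a3 z3 Taz _] := az.
  by have := O_free oO oz z3 a3; rewrite Tsym Taz.
have O_nbr_O o z : o \in O -> cadj o z -> z \notin O.
  move=> oO oz; apply/negP => zO; have /(cadjP F)[oc zc _] := oz.
  have /(cadjP F)[_ _] := oz; rewrite -(O_uniq oO zO) => -[] e.
    by have := next_neq Uc (ltnW (frame_size F)) oc; rewrite -e eqxx.
  by have := next_neq Uc (ltnW (frame_size F)) oc; rewrite {1}e (next_prev Uc) eqxx.
apply: (two_coloring F GE (X := P2 :|: P3) (M := moved :|: O) (Q := Q)).
- move=> a b m Tab aD bD; rewrite inE /Q => /orP[mM|mO]; last first.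
    have no u v : T u v -> u \notin P2 :|: P3 -> v \notin P2 :|: P3 -> u != next c m.
      move=> Tuv uD vD; apply: contraTneq (O_deleted m mO) => eu.
      have lu : leaf T u by rewrite eu -(frame_leaf F) mem_next (frame_leaf F) leafO.
      by rewrite -O_next // -eu -(parent_eq lu Tuv).
    rewrite (negbTE (O_moved m mO)) !inE (negbTE (no a b Tab aD bD)).
    by rewrite (negbTE (no b a _ bD aD)) // Tsym.
  rewrite mM; have cross u v : T u v -> u \notin P2 :|: P3 -> v \notin P2 :|: P3 ->
      u \in branch m -> v \in branch m.
    move=> Tuv uD vD uQ; apply/negPn/negP => vQ.
    have [_ ev] := side_exit Tuv uQ vQ.
    by rewrite ev hub_deleted in vD.
  by apply/idP/idP; apply: cross; rewrite // Tsym.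
- move=> a b ab aD bD.
  case: (cover ab) => [aX|bX|aO|bO]; rewrite !in_setU.
  + by left; apply/orP; left; apply/negPn/negP => /(deleted aX); rewrite (negbTE aD).
  + by right; apply/orP; left; apply/negPn/negP => /(deleted bX); rewrite (negbTE bD).
  + by left; rewrite aO orbT.
  by right; rewrite bO orbT.
- move=> m b; rewrite in_setU => /orP[mM|mO] Tmb.
    by rewrite (parent_eq (leaf3 (moved3 mM)) Tmb) hub_deleted.
  by rewrite (parent_eq (leafO mO) Tmb) O_deleted.
- move=> m b; rewrite !in_setU negb_or => /orP[mM|mO] mb.
    apply/andP; split.
      by apply: contra (indX mb (X3X (moved3 mM))) => /moved3/X3X.
    by apply/negP => bO; have := O_nbr_unmoved b m bO; rewrite cadjC mM => /(_ mb).
  by rewrite (O_nbr_unmoved m b) // (O_nbr_O m b).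
- move=> m; rewrite in_setU /Q => /orP[mM|mO].
    rewrite mM; have [l lm] := movedP _ mM.
    have [mq ql qm _] := branchP lm; have /and4P[l3 m3 Tlm _] := lm.
    have nadj : ~~ cadj l m by apply: contraTN (X3X m3) => /indX; apply; apply: X3X.
    exact: (between_ends F (leaf3 l3) (leaf3 m3) Tlm nadj mq ql qm).
  rewrite (negbTE (O_moved m mO)) !inE eqxx /=; apply/eqP => e.
  have mc : m \in c by rewrite (frame_leaf F) leafO.
  by have := next2_neq Uc (frame_size F) mc; rewrite -e (next_prev Uc) eqxx.
move=> m m'; rewrite !in_setU => mM' m'M' ne; rewrite /Q.
have mc : m \in c.
  by rewrite (frame_leaf F); case/orP: mM' => [/moved3/leaf3|/leafO].
have [m'M|m'M] := boolP (m' \in moved); last first.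
  have m'O : m' \in O by rewrite (negbTE m'M) in m'M'.
  have mM : m \in moved.
    by case/orP: mM' => // mO; rewrite (O_uniq mO m'O) eqxx in ne.
  rewrite !inE (inj_eq (next_inj Uc)) (negbTE ne); symmetry; apply/eqP => e.
  have := O_next2 m'O; rewrite -e (next_prev Uc) mM //.
have stay z : cadj m z -> (z \in branch m') = (m \in branch m').
  move=> mz; have [mQ|mQ] := boolP (m \in branch m').
    apply/negPn/negP => zQ; have [l lm' ez] := branch_cross m'M mz mQ zQ.
    have /and4P[l3 m'3 Tlm' _] := lm'.
    have z3 : z \in X3 by case: ez => ->.
    case/orP: mM' => [mM|mO].
      by have := indX mz (X3X (moved3 mM)); rewrite X3X.
    case: ez => ez; rewrite ez in mz z3.
      by have := O_free mO mz z3 m'3; rewrite Tlm'.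
    by have := O_free mO mz z3 l3; rewrite Tsym Tlm'.
  apply/negP => zQ; rewrite cadjC in mz.
  have [l lm' [em|em]] := branch_cross m'M mz zQ mQ; last by rewrite em eqxx in ne.
  have /and4P[l3 _ _ _] := lm'; have := conflict_unmoved lm'.
  case/orP: mM' => [mM|mO]; first by rewrite -em mM.
  by have := O_X mO; rewrite em X3X.
by rewrite !stay ?cadj_next ?(cadj_prev F).
Qed.

Theorem repaired_packing : packing_colorable [:: 1; 1; 2; 3] G.
Proof.
have [chi chiP] := forest_colouring.
have far2C u v : ~~ G u v /\ (forall m, G u m -> ~~ G m v) ->
    ~~ G v u /\ (forall m, G v m -> ~~ G m u).
  move=> [h1 h2]; rewrite Gsym; split=> // m vm; rewrite Gsym.
  by apply: contraL vm => /h2; rewrite Gsym.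
have far3C u v : [/\ ~~ G u v, forall m, G u m -> ~~ G m v
      & forall m m', G u m -> G m m' -> ~~ G m' v] ->
    [/\ ~~ G v u, forall m, G v m -> ~~ G m u
      & forall m m', G v m -> G m m' -> ~~ G m' u].
  move=> [h1 h2 h3]; have [h4 h5] := far2C u v (conj h1 h2); split=> // m m' vm mm'.
  rewrite Gsym; apply: contraL vm => um'; rewrite Gsym.
  by apply: h3 um' _; rewrite Gsym.
apply: (packing_of_classes chiP).
- move=> v; rewrite !in_setU in_setD => /orP[/orP[v2|vh]|vU].
  + rewrite (negbTE (disjX v2)) andbF /=; apply: contraL (leaf2 v2).
    exact: U3_internal.
  + rewrite negb_or negb_and negbK; apply/andP; split.
      by apply/orP; right; apply: contra (hub_internal vh) => /leaf3.
    by apply: contraL vh => /U3_hub.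
  rewrite (negbTE (U23 vU)) orbF negb_and; apply/orP; right.
  by apply: contra (U2_internal vU) => /leaf3.
- move=> u v; rewrite !in_setU => /orP[/orP[u2|uh]|uU] /orP[/orP[v2|vh]|vU] uv.
  + exact: far_X2.
  + by apply/far2C/far_hub_X2.
  + by apply/far2C/U2_far; rewrite // in_setU u2.
  + exact: far_hub_X2.
  + exact: far_hub.
  + by apply/far2C/U2_far; rewrite // in_setU uh orbT.
  + by apply: U2_far; rewrite // in_setU v2.
  + by apply: U2_far; rewrite // in_setU vh orbT.
  by rewrite (U2_uniq uU vU) eqxx in uv.
move=> u v; rewrite !(in_setU _ _ U3) => /orP[u3|uU] /orP[v3|vU] uv.
- exact: far_X3.
- by apply/far3C/U3_far.
- exact: U3_far.
by rewrite (U3_uniq uU vU) eqxx in uv.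
Qed.

End Repair.

(** * An end of the tree *)

Section EndOfTree.
Variables (V : finType) (T : sgraph V) (c : seq V).
Hypothesis F : halin_frame T c.
Implicit Types a b d e g l m o p q u v w x y z : V.
Let treeT := frame_tree F.
Let Uc := frame_uniq F.
Let Tsym := adj_sym T.
Local Notation cadj := (cycle_edge c).
Local Notation parent := (parent T).

Definition cherry u w l l' : Prop :=
  [/\ ~~ leaf T u, T u w, T u l & T u l'] /\ [/\ leaf T l, leaf T l' & l != l'].

Lemma cherry_nbrs u w l l' : ~~ leaf T w -> cherry u w l l' ->
  forall e, T u e -> [\/ e = w, e = l | e = l'].
Proof.
move=> iw [[iu uw ul ul'] [ll ll' ne]].
have wl : w != l by apply: contraNneq iw => ->.
have wl' : w != l' by apply: contraNneq iw => ->.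
have [g [_ _ _ nbrs]] := third_nbr F iu uw ul wl.
case: (nbrs _ ul') => e; rewrite e ?eqxx // in wl' ne *.
Qed.

Lemma cherry_cadj u w l l' : cherry u w l l' -> cadj l l'.
Proof.
move=> [[iu uw ul ul'] [ll ll' ne]]; apply: (siblings_cadj F) => //.
by rewrite -(parent_eq ll (p := u)) 1?Tsym // -(parent_eq ll' (p := u)) // Tsym.
Qed.

(** Among the edges with at least four vertices beyond them, take one with as few
    as possible. The branches at its far end [w] have at most three vertices, so
    they are leaves and cherries, and they are not both leaves. *)
Lemma end_of_tree : 4 < #|V| -> exists u w x y l l',
  [/\ cherry u w l l', [/\ ~~ leaf T w, T w x & T w y], [/\ x != u, y != u & x != y]
    & leaf T x \/ exists z z', cherry x w z z'].
Proof.
move=> V5.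
pose P (e : V * V) := T e.1 e.2 && (3 < #|side T e.1 e.2|).
have [l lc] : exists l, l \in c.
  by case: (c) (frame_size F) => // l s _; exists l; apply: mem_head.
have ll : leaf T l by rewrite -(frame_leaf F).
have Pl : P (l, parent l).
  rewrite /P /= parentP //= (sideC treeT (x := parent l)) 1?Tsym ?parentP //.
  have -> : side T (parent l) l = [set l].
    apply/setP => v; rewrite in_set1; apply/idP/eqP => [vS|->]; last exact: mem_side.
    by apply: (leaf_side F _ ll vS); rewrite Tsym parentP.
  by move: (cardsC [set l]); rewrite cards1; lia.
have [[y w] /andP[/= Tyw big] min] := @arg_minnP _ (l, parent l) P (fun f : V * V => #|side T f.1 f.2|) Pl.
have Twy : T w y by rewrite Tsym.
have iw : ~~ leaf T w.
  apply: contraL big => lw; rewrite -leqNgt.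
  apply: (@leq_trans #|[set w]|); last by rewrite cards1.
  by apply/subset_leq_card/subsetP => v /(leaf_side F Tyw lw)->; rewrite inE.
have small a : T w a -> a != y -> #|side T w a| <= 3.
  move=> wa ay; rewrite leqNgt; apply/negP => gt3.
  have /= := min (w, a); rewrite /P /= wa gt3 => /(_ isT); rewrite leqNgt => /negP; apply.
  apply: proper_card; apply/properP; split; first exact: side_sub.
  by exists w; rewrite ?mem_side // (side_irr treeT).
have child a : T w a -> a != y -> leaf T a \/ exists z z', cherry a w z z'.
  move=> wa ay; have [la|ia] := boolP (leaf T a); [by left|right].
  have aw : T a w by rewrite Tsym.
  have [z [z' [[az az' zw z'w zz'] _]]] := internal_nbrs F ia aw.
  have lz d : T a d -> d != w -> leaf T d.
    move=> ad dw; apply/negPn/negP => id_.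
    have da : T d a by rewrite Tsym.
    have [f [g [[df dg fa ga fg] _]]] := internal_nbrs F id_ da.
    have fS : f \in side T a d by apply: (side_nbr F).
    have gS : g \in side T a d by apply: (side_nbr F).
    have sub e : e \in side T a d -> e \in side T w a.
      by apply: subsetP e; apply: side_sub.
    have := small a wa ay; rewrite leqNgt => /negP; apply.
    rewrite cardE; apply: (@uniq_leq_size _ [:: a; d; f; g]).
      have ne e : e \in side T a d -> a != e.
        by move=> eS; apply: contraTneq eS => <-; apply: side_irr.
      have nd e : T d e -> d != e by move=> de; apply: contraTneq de => <-; rewrite adj_irrefl.
      by rewrite /= !inE !negb_or !ne ?mem_side // !nd // fg.
    move=> e; rewrite mem_enum in_cons in_cons in_cons in_cons in_nil orbF.
    by case/or4P => /eqP->; [| apply: sub | apply: sub | apply: sub]; rewrite ?mem_side.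
  by exists z, z'; split; split=> //; apply: lz.
have [a [b [[wa wb ay by_ ab] nbrs]]] := internal_nbrs F iw Twy.
have not_both : ~~ (leaf T a && leaf T b).
  apply: contraL big => /andP[la lb]; rewrite -leqNgt.
  apply: (@leq_trans #|[set w; a; b]|); last first.
    by rewrite -setUA cardsU1 cards2; case: (_ \notin _); case: (_ != _).
  apply/subset_leq_card/subsetP => v vS; have [->|vw] := eqVneq v w; first by rewrite !inE eqxx.
  have [e [we ey ve]] := side_split treeT Tyw vS vw.
  case: (nbrs _ we) => ee; rewrite ee ?eqxx // in we ve ey.
    by rewrite (leaf_side F we la ve) !inE eqxx orbT.
  by rewrite (leaf_side F we lb ve) !inE eqxx !orbT.
have [la|[z [z' za]]] := child a wa ay.
  have [lb|[z [z' zb]]] := child b wb by_; first by rewrite la lb in not_both.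
  by exists b, w, a, y, z, z'; split=> //; [split; rewrite // eq_sym|left].
exists a, w, b, y, z, z'; split=> //; last exact: child.
by split; rewrite // eq_sym.
Qed.

(** The three leaves beyond [w] are consecutive, and so are the two leaves of the
    cherry among them. *)
Lemma cherry_third u w l l' z : ~~ leaf T w -> cherry u w l l' ->
  T w z -> leaf T z -> cadj z l \/ cadj z l'.
Proof.
move=> iw ch wz lz; have [[iu uw ul ul'] [ll ll' ne]] := ch.
have wu : T w u by rewrite Tsym.
have uz : u != z by apply: contraNneq iu => ->.
have [g [wg gu gz nbrs]] := third_nbr F iw wu wz uz.
have gw : T g w by rewrite Tsym.
have [zl|nzl] := boolP (cadj z l); first by left.
right; apply/negPn/negP => nzl'.
have inS v : leaf T v -> v \in side T g w -> [\/ v = l, v = l' | v = z].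
  move=> lv vS; have vw : v != w by apply: contraNneq iw => <-.
  have [e [we eo ve]] := side_split treeT gw vS vw.
  case: (nbrs _ we) => ee; rewrite ee ?eqxx // in we ve eo.
    have vu : v != u by apply: contraNneq iu => <-.
    have [f [uf fw vf]] := side_split treeT wu ve vu.
    case: (cherry_nbrs iw ch uf) => ef; rewrite ef ?eqxx // in uf vf fw.
      by constructor 1; apply: (leaf_side F uf ll).
    by constructor 2; apply: (leaf_side F uf ll').
  by constructor 3; apply: (leaf_side F wz lz).
have zS : z \in side T g w by apply: (side_nbr F); rewrite // eq_sym.
have sub e : e \in side T w u -> e \in side T g w.
  by apply: subsetP e; apply: side_sub; rewrite // eq_sym.
have lS : l \in side T g w.
  by apply: sub; apply: (side_nbr F) => //; apply: contraNneq iw => <-.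
have l'S : l' \in side T g w.
  by apply: sub; apply: (side_nbr F) => //; apply: contraNneq iw => <-.
have zc : z \in c by rewrite (frame_leaf F).
have lc : l \in c by rewrite (frame_leaf F).
have l'c : l' \in c by rewrite (frame_leaf F).
have sz1 := ltnW (frame_size F).
have leaf_next v : v \in c -> leaf T (next c v) by rewrite -(frame_leaf F) mem_next.
have exit_z : next c z \notin side T g w.
  apply/negP => /inS[]; first exact: leaf_next.
  - by move=> e; rewrite -e cadj_next in nzl.
  - by move=> e; rewrite -e cadj_next in nzl'.
  by apply/eqP; apply: next_neq.
have off v v' : v \in c -> v' \in c -> next c v = v' ->
   ~~ cadj z v' -> (forall t, [\/ t = l, t = l' | t = z] -> [\/ t = v, t = v' | t = z]) ->
   next c v' \notin side T g w.
  move=> vc v'c vv' nzv' tE; apply/negP => /inS/tE[]; first exact: leaf_next.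
  - by rewrite -vv'; apply/eqP; apply: next2_neq; rewrite // (frame_size F).
  - by apply/eqP; apply: next_neq.
  by move=> e; rewrite cadjC -e cadj_next in nzv'.
have nbE v : leaf T v -> T u v -> v != z.
  move=> lv uv; apply: contraTneq uw => e; rewrite (parent_eq lv (p := u)) 1?Tsym // e.
  by rewrite -(parent_eq lz (p := w)) 1?Tsym ?adj_irrefl.
case/(cadjP F): (cherry_cadj ch) => _ _ [e|e].
  have := nbE l' ll' ul'; case/eqP; apply: (frame_arc F gw) => //.
  by apply: (off l l').
have e' : next c l' = l by rewrite e (next_prev Uc).
have := nbE l ll ul; case/eqP; apply: (frame_arc F gw) => //.
apply: (off l' l) => //.
by move=> t []->; [constructor 2|constructor 1|constructor 3].
Qed.

End EndOfTree.

(** * Marking every second leaf *)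

(** When [n] is not a multiple of 4 the pattern has a seam at the leaf 0, which
    belongs to the chosen cherry with parent u: the edges without a mark meet the
    leaf 0. The residues are chosen so that, through the leaves 0 and 1, the
    marks 2 are at distance 3 or more from u if [n] is 1 or 2 modulo 4, and the
    marks 3 at distance 4 or more from u if [n] is 3 modulo 4. *)
Definition mark2 (n i : nat) : bool :=
  match n %% 4 with
  | 0 => i %% 4 == 1 | 1 => i %% 4 == 3
  | 2 => (0 < i) && (i %% 4 == 0) | _ => i %% 4 == 2 end.

Definition mark3 (n i : nat) : bool :=
  match n %% 4 with
  | 0 => i %% 4 == 3 | 1 => i %% 4 == 1
  | 2 => i %% 4 == 2 | _ => (0 < i) && (i %% 4 == 0) end.

Definition succ_mod (n i j : nat) : bool := (j == i.+1) || (i.+1 == n) && (j == 0).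
Definition adj_mod (n i j : nat) : bool := succ_mod n i j || succ_mod n j i.

Lemma mark_disjoint n i : mark2 n i -> ~~ mark3 n i.
Proof. rewrite /mark2 /mark3; case: (n %% 4) => [|[|[|k]]]; lia. Qed.

Lemma mark_independent n i j : 2 < n -> i < n -> j < n -> adj_mod n i j ->
  mark2 n i || mark3 n i -> ~~ (mark2 n j || mark3 n j).
Proof.
rewrite /mark2 /mark3 /adj_mod /succ_mod; have := ltn_mod n 4.
by case E: (n %% 4) => [|[|[|[|k]]]] //=; lia.
Qed.

Lemma mark_gap2 n i m j : 2 < n -> i < n -> m < n -> j < n ->
  adj_mod n i m -> adj_mod n m j -> i != j ->
  (mark2 n i -> ~~ mark2 n j) /\ (mark3 n i -> ~~ mark3 n j).
Proof.
rewrite /mark2 /mark3 /adj_mod /succ_mod; have := ltn_mod n 4.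
by case E: (n %% 4) => [|[|[|[|k]]]] //=; lia.
Qed.

Lemma mark_gap3 n i k m j : 2 < n -> i < n -> k < n -> m < n -> j < n ->
  adj_mod n i k -> adj_mod n k m -> adj_mod n m j -> i != j ->
  mark3 n i -> ~~ mark3 n j.
Proof.
rewrite /mark3 /adj_mod /succ_mod; have := ltn_mod n 4.
by case E: (n %% 4) => [|[|[|[|q]]]] //=; lia.
Qed.

Lemma mark_cover n i j : 2 < n -> i < n -> j < n -> adj_mod n i j ->
  [|| mark2 n i, mark3 n i, mark2 n j | mark3 n j]
  || (0 < n %% 4) && ((i == 0) || (j == 0)).
Proof.
rewrite /mark2 /mark3 /adj_mod /succ_mod; have := ltn_mod n 4.
by case E: (n %% 4) => [|[|[|[|q]]]] //=; lia.
Qed.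

Lemma adj_mod_near n i : 2 < n -> adj_mod n i 0 \/ adj_mod n i 1 ->
  i != 0 -> i != 1 -> i = 2 \/ i.+1 = n.
Proof. rewrite /adj_mod /succ_mod; lia. Qed.

Lemma adj_mod_from0 n i : adj_mod n 0 i -> i <= 2 \/ i.+1 = n.
Proof. rewrite /adj_mod /succ_mod; lia. Qed.

Lemma adj_mod_from1 n i : 2 < n -> adj_mod n 1 i -> i <= 2.
Proof. rewrite /adj_mod /succ_mod; lia. Qed.

Lemma adj_mod_beyond n i j : i <= 2 \/ i.+1 = n -> adj_mod n i j ->
  j <= 3 \/ n <= j.+2.
Proof. rewrite /adj_mod /succ_mod; lia. Qed.

Lemma mark3_0 n : mark3 n 0 = false.
Proof. by rewrite /mark3; case: (n %% 4) => [|[|[|k]]]. Qed.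

Lemma mark3_1 n : mark3 n 1 -> n %% 4 = 1.
Proof. by rewrite /mark3; case: (n %% 4) => [|[|[|k]]]. Qed.

Lemma mark3_near n i : 0 < n %% 4 -> i = 2 \/ i.+1 = n -> mark3 n i ->
  i = 2 /\ n %% 4 = 2.
Proof.
rewrite /mark3; have := ltn_mod n 4.
by case E: (n %% 4) => [|[|[|[|k]]]] //=; lia.
Qed.

Lemma mark2_near n i : n %% 4 = 1 \/ n %% 4 = 2 -> i <= 2 \/ i.+1 = n ->
  mark2 n i = false.
Proof. by rewrite /mark2; case=> E; rewrite E /=; lia. Qed.

Lemma mark3_beyond n i : n %% 4 = 3 -> i < n -> i <= 3 \/ n <= i.+2 ->
  mark3 n i = false.
Proof. by rewrite /mark3 => E; rewrite E /=; lia. Qed.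

Section Marking.
Variables (V : finType) (G T : sgraph V) (c : seq V).
Hypothesis F : halin_frame T c.
Hypothesis GE : forall x y, G x y = T x y || cycle_edge c x y.
Implicit Types a b d e g l m o p q u v w x y z : V.
Let treeT := frame_tree F.
Let Uc := frame_uniq F.
Let Tsym := adj_sym T.
Let n := size c.
Let n2 : 2 < n. Proof. exact: frame_size F. Qed.
Local Notation cadj := (cycle_edge c).
Local Notation parent := (parent T).
Local Notation idx v := (index v c).

Definition marked2 : {set V} := [set v | (v \in c) && mark2 n (idx v)].
Definition marked3 : {set V} := [set v | (v \in c) && mark3 n (idx v)].

Lemma cadj_index a b : cadj a b ->
  [/\ a \in c, b \in c, idx a < n, idx b < n & adj_mod n (idx a) (idx b)].
Proof.
case/and3P=> ac bc e; split=> //; rewrite ?index_mem //.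
have step v : v \in c -> succ_mod n (idx v) (idx (next c v)).
  move=> vc; rewrite /succ_mod index_next // -/n.
  by case: (_.+1 == n); rewrite ?eqxx ?orbT.
rewrite /adj_mod; case/orP: e => /eqP<-; first by rewrite step.
by rewrite orbC step.
Qed.

Lemma marked_leaf v : v \in marked2 :|: marked3 -> leaf T v.
Proof. by rewrite !inE -(frame_leaf F) => /orP[]/andP[]. Qed.

Lemma marked_disjoint v : v \in marked2 -> v \notin marked3.
Proof. by rewrite !inE => /andP[-> /mark_disjoint]. Qed.

Lemma marked_independent a b : cadj a b ->
  a \in marked2 :|: marked3 -> b \notin marked2 :|: marked3.
Proof.
case/cadj_index => ac bc ia ib ab; rewrite !inE ac bc /=.
exact: mark_independent n2 ia ib ab.
Qed.

Lemma index_eqc a b : a \in c -> (idx a == idx b) = (a == b).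
Proof.
move=> ac; apply/eqP/eqP => [e|->//].
by rewrite -(nth_index a ac) e nth_index // -index_mem -e index_mem.
Qed.

Lemma marked_gap2 a m b : cadj a m -> cadj m b -> a != b ->
  (a \in marked2 -> b \notin marked2) /\ (a \in marked3 -> b \notin marked3).
Proof.
case/cadj_index => ac mc ia im am /cadj_index[_ bc _ ib mb].
rewrite -index_eqc // !inE ac bc /=.
exact: mark_gap2 n2 ia im ib am mb.
Qed.

Lemma marked_gap3 a m m' b : cadj a m -> cadj m m' -> cadj m' b -> a != b ->
  a \in marked3 -> b \notin marked3.
Proof.
case/cadj_index => ac mc ia im am /cadj_index[_ m'c _ im' mm'].
case/cadj_index => _ bc _ ib m'b; rewrite -index_eqc // !inE ac bc /=.
exact: mark_gap3 n2 ia im im' ib am mm' m'b.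
Qed.

Lemma marked_cover a b : cadj a b ->
  [|| a \in marked2 :|: marked3, b \in marked2 :|: marked3
    | (0 < n %% 4) && ((idx a == 0) || (idx b == 0))].
Proof.
case/cadj_index => ac bc ia ib ab; have := mark_cover n2 ia ib ab.
by rewrite !inE ac bc /= !orbA.
Qed.

Lemma packing_mod0 : n %% 4 = 0 -> packing_colorable [:: 1; 1; 2; 3] G.
Proof.
move=> n0; have [r _] : exists r, r \in c.
  by case: (c) (frame_size F) => // l s _; exists l; apply: mem_head.
apply: (@repaired_packing V G T c F GE marked2 marked3 r marked_leaf
  marked_disjoint marked_independent marked_gap2 marked_gap3 set0 set0 set0);
  do ?[by move=> o; rewrite in_set0 | by move=> o o'; rewrite in_set0
      | by move=> o z a; rewrite in_set0].
move=> a b /marked_cover/or3P[aX|bX|]; last by rewrite n0.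
  by constructor 1.
by constructor 2.
Qed.

Variables (u w a0 a1 : V) (s : seq V).
Hypothesis n4 : 0 < n %% 4.
Hypothesis c_eq : c = [:: a0, a1 & s].
Hypothesis uch : cherry T u w a0 a1.
Hypothesis iw : ~~ leaf T w.

Let iu : ~~ leaf T u. Proof. by case: uch => -[]. Qed.
Let uw : T u w. Proof. by case: uch => -[]. Qed.
Let wu : T w u. Proof. by rewrite Tsym. Qed.
Let ua0 : T u a0. Proof. by case: uch => -[]. Qed.
Let ua1 : T u a1. Proof. by case: uch => -[]. Qed.
Let la0 : leaf T a0. Proof. by case: uch => _ []. Qed.
Let la1 : leaf T a1. Proof. by case: uch => _ []. Qed.
Let nb_a0 : parent a0 = u. Proof. by rewrite -(parent_eq la0 (p := u)) // Tsym. Qed.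
Let nb_a1 : parent a1 = u. Proof. by rewrite -(parent_eq la1 (p := u)) // Tsym. Qed.
Let idx0 : idx a0 = 0. Proof. by rewrite c_eq /= eqxx. Qed.
Let a01 : a0 != a1. Proof. by case: uch => _ []. Qed.
Let idx1 : idx a1 = 1. Proof. by rewrite c_eq /= (negbTE a01) eqxx. Qed.
Let a0c : a0 \in c. Proof. by rewrite (frame_leaf F). Qed.
Let a1c : a1 \in c. Proof. by rewrite (frame_leaf F). Qed.
Let next_a0 : next c a0 = a1. Proof. by rewrite c_eq /= eqxx. Qed.
Let inc v : leaf T v -> v \in c. Proof. by rewrite (frame_leaf F). Qed.

Lemma w_leaf_index z : T w z -> leaf T z -> idx z = 2 \/ (idx z).+1 = n.
Proof.
move=> wz lz.
have off a : T u a -> leaf T a -> idx z != idx a.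
  move=> ua la; rewrite index_eqc ?inc //; apply: contraTneq uw => e.
  rewrite -e in ua la; rewrite (parent_eq lz (p := u)) 1?Tsym //.
  by rewrite -(parent_eq lz (p := w)) 1?Tsym // adj_irrefl.
have := off a1 ua1 la1; have := off a0 ua0 la0; rewrite idx0 idx1.
apply: (adj_mod_near n2); have := cherry_third F iw uch wz lz.
by case=> /cadj_index[_ _ _ _]; rewrite ?idx0 ?idx1; [left|right].
Qed.

Lemma u_walk1 v : leaf T v -> G u v -> idx v < 2.
Proof.
move=> lv /(adj_internal F GE iu)/(cherry_nbrs F iw uch)[] e; rewrite e ?idx0 ?idx1 //.
by rewrite e (negbTE iw) in lv.
Qed.

Lemma u_walk2 m v : leaf T v -> G u m -> G m v -> idx v <= 2 \/ (idx v).+1 = n.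
Proof.
move=> lv /(adj_internal F GE iu)/(cherry_nbrs F iw uch)[] ->.
- by move=> /(adj_internal F GE iw) wv; case: (w_leaf_index wv lv) => ->; [left|right].
- move=> /(adj_leaf GE la0)[e|]; first by rewrite e nb_a0 (negbTE iu) in lv.
  by case/cadj_index => _ _ _ _; rewrite idx0; apply: adj_mod_from0.
move=> /(adj_leaf GE la1)[e|]; first by rewrite e nb_a1 (negbTE iu) in lv.
by case/cadj_index => _ _ _ _; rewrite idx1 => /(adj_mod_from1 n2); left.
Qed.

Lemma u_walk3 m m' v : leaf T v -> G u m -> G m m' -> G m' v ->
  [\/ idx v <= 3, n <= (idx v).+2 | T w (parent v)].
Proof.
move=> lv um mm' m'v.
have [lm'|im'] := boolP (leaf T m').
  have [e|] := adj_leaf GE lm' m'v.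
    by rewrite e (negbTE (parent_internal F lm')) in lv.
  case/cadj_index => _ _ _ _ /(adj_mod_beyond (u_walk2 lm' um mm'))[h|h].
    by constructor 1.
  by constructor 2.
have em' : m' = parent v by apply: (parent_eq lv); rewrite Tsym; apply: (adj_internal F GE im').
case: (cherry_nbrs F iw uch (adj_internal F GE iu um)) => em; rewrite em in mm'.
- by constructor 3; rewrite -em'; apply: (adj_internal F GE iw).
- case: (adj_leaf GE la0 mm') => [e|/(cadj_leaf F)[_]]; last by rewrite (negbTE im').
  by rewrite e nb_a0 in m'v; constructor 1; exact: leq_trans (ltnW (u_walk1 lv m'v)) _.
case: (adj_leaf GE la1 mm') => [e|/(cadj_leaf F)[_]]; last by rewrite (negbTE im').
by rewrite e nb_a1 in m'v; constructor 1; exact: leq_trans (ltnW (u_walk1 lv m'v)) _.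
Qed.

Let marked3_mark v : v \in marked3 -> leaf T v /\ mark3 n (idx v).
Proof. by rewrite inE -(frame_leaf F) => /andP. Qed.
Let marked2_mark v : v \in marked2 -> leaf T v /\ mark2 n (idx v).
Proof. by rewrite inE -(frame_leaf F) => /andP. Qed.

(** If a leaf of the cherry is moved, its conflict is with a leaf hanging from
    [w], whose index is 2 or [n.-1]; but neither is marked 3 when 1 is. *)
Lemma u_notin_hub : u \notin hub T marked3 u.
Proof.
apply/negP => /imsetP[b bM ub]; have b3 := moved3 bM.
have [lb mb] := marked3_mark b3.
have Tub : T u b by rewrite ub Tsym parentP.
case: (cherry_nbrs F iw uch Tub) => e.
- by rewrite e (negbTE iw) in lb.
- by rewrite e idx0 mark3_0 in mb.
move: mb bM; rewrite e idx1 => /mark3_1 m1 /movedP[a /and4P[a3 _ Ta _]].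
rewrite nb_a1 in Ta; have Tua : T u (parent a) by rewrite Tsym.
have [la ma] := marked3_mark a3.
have nba := parent_internal F la.
case: (cherry_nbrs F iw uch Tua) => ea; try by rewrite ea ?la0 ?la1 in nba.
have wa : T w a by rewrite -ea Tsym parentP.
by have [_] := mark3_near n4 (w_leaf_index wa la) ma; rewrite m1.
Qed.

(** A hub at distance at most 2 from [u] is [w] or a neighbour of [w]. In both
    cases a leaf marked 3 hangs from [w], which forces its index to be 2 and [n]
    to be 2 modulo 4. If [w] is the hub, the conflict is with a leaf of the
    cherry, which is not marked 3. If not, the branch [u] lies between the two
    leaves of the conflict, and by [outer_leaf] the leaf 0 is next to one of
    them; but none of its neighbours is marked 3. *)
Lemma hub_far_u p : n %% 4 = 1 \/ n %% 4 = 2 -> p \in hub T marked3 u ->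
  ~~ G u p /\ forall m, G u m -> ~~ G m p.
Proof.
move=> n12 ph; have pu : p != u by apply: contraTneq ph => ->; apply: u_notin_hub.
have ip := hub_internal F marked_leaf ph.
case/imsetP: ph => b bM ep; have [a ab] := movedP _ _ _ _ bM.
have /and4P[a3 b3 Tab uS] := ab.
have [la ma] := marked3_mark a3; have [lb mb] := marked3_mark b3.
have Tpb : T p b by rewrite ep Tsym parentP.
rewrite -ep in Tab uS; have Tpa : T p (parent a) by rewrite Tsym.
have w_leaf3 z : T w z -> leaf T z -> mark3 n (idx z) -> idx z = 2 /\ n %% 4 = 2.
  by move=> wz lz; apply: mark3_near n4 (w_leaf_index wz lz).
have not_w : p != w.
  apply/eqP => epw; rewrite epw in Tpb uS Tpa.
  have [ib n2'] := w_leaf3 b Tpb lb mb.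
  have eu : parent a = u.
    apply/eqP/negPn/negP => nu; rewrite eq_sym in nu.
    by have := side_disjoint treeT wu Tpa nu (mem_side _ _ _); rewrite uS.
  have ua : T u a by rewrite -eu Tsym parentP.
  move: ma; rewrite /mark3 n2'.
  case: (cherry_nbrs F iw uch ua) => e; rewrite e ?idx0 ?idx1 //.
  by rewrite e (negbTE iw) in la.
split.
  apply/negP => /(adj_internal F GE iu)/(cherry_nbrs F iw uch)[] e.
  - by rewrite e eqxx in not_w.
  - by rewrite e la0 in ip.
  by rewrite e la1 in ip.
move=> m um; apply/negP => mp.
case: (cherry_nbrs F iw uch (adj_internal F GE iu um)) => em; rewrite em in mp.
- have wp := adj_internal F GE iw mp.
  have pw : T p w by rewrite Tsym.
  have up : u != p by rewrite eq_sym.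
  have ea : parent a = w.
    apply/eqP/negPn/negP => na; have := side_disjoint treeT Tpa pw na uS.
    by rewrite (side_nbr F pw wu up).
  have wa : T w a by rewrite -ea Tsym parentP.
  have [ia n2'] := w_leaf3 a wa la ma.
  have nadj : ~~ cadj b a.
    have bX : b \in marked2 :|: marked3 by rewrite inE b3 orbT.
    by apply/negP => ba; have := marked_independent ba bX; rewrite inE a3 orbT.
  have Tba : T (parent b) (parent a) by rewrite -ep.
  have ua : u != a by apply: contraTneq la => <-.
  have Tau : T (parent a) u by rewrite ea.
  have unb : u != parent b by rewrite -ep.
  have n5 : 3 < n by move: n2 n2'; clear; move: n => [|[|[|[|k]]]].
  case: (outer_leaf F lb la Tba nadj Tau unb ua la0 ua0) => /cadj_index[_ _ _ _];
    rewrite idx0 ?ia; last by move: n5; rewrite /adj_mod /succ_mod; clear; lia.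
  move: mb n2'; rewrite /mark3 /adj_mod /succ_mod; move: (idx b) n => i k.
  by clear => + E; rewrite E /=; lia.
- case: (adj_leaf GE la0 mp) => [e|/(cadj_leaf F)[_]]; last by rewrite (negbTE ip).
  by rewrite e nb_a0 eqxx in pu.
case: (adj_leaf GE la1 mp) => [e|/(cadj_leaf F)[_]]; last by rewrite (negbTE ip).
by rewrite e nb_a1 eqxx in pu.
Qed.

(** The neighbours 1 and [n.-1] of the leaf 0 are not in conflict: if marked 3 at
    all, such a leaf is 1, and then no leaf hanging from [w] is marked 3. *)
Lemma cherry_free z a : cadj a0 z -> z \in marked3 -> a \in marked3 ->
  ~~ T (parent z) (parent a).
Proof.
move=> /cadj_index[_ _ _ iz a0z] /marked3_mark[lz mz] /marked3_mark[la ma].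
have [ez|nz1] := eqVneq z a1; last first.
  have iz1 : idx z != 1 by rewrite -idx1 index_eqc ?inc.
  have iz0 : idx z != 0.
    by apply: contraTneq mz => ->; rewrite mark3_0.
  have az0 : adj_mod n (idx z) 0 by move: a0z; rewrite idx0 /adj_mod orbC.
  have iz2 := adj_mod_near n2 (or_introl az0) iz0 iz1.
  have [i2 _] := mark3_near n4 iz2 mz; move: az0 (n2) iz2 mz.
  rewrite i2 /adj_mod /succ_mod /mark3; move: n => k; clear.
  have := ltn_mod k 4; by case E: (k %% 4) => [|[|[|[|q]]]] //=; lia.
rewrite ez nb_a1; apply/negP => unb; have nba := parent_internal F la.
case: (cherry_nbrs F iw uch unb) => ea; try by rewrite ea ?la0 ?la1 in nba.
have wa : T w a by rewrite -ea Tsym parentP.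
have [_] := mark3_near n4 (w_leaf_index wa la) ma.
by move: mz; rewrite ez idx1 => /mark3_1 ->.
Qed.

Lemma cherry_cover a b : cadj a b ->
  [\/ a \in marked2 :|: marked3, b \in marked2 :|: marked3, a \in [set a0] | b \in [set a0]].
Proof.
move=> ab; have [ac bc _ _ _] := cadj_index ab.
case/or3P: (marked_cover ab) => [h|h|]; [by constructor 1|by constructor 2|].
rewrite !in_set1 -!(index_eqc a0) // ?idx0; case/andP=> _.
by case/orP=> h; [constructor 3|constructor 4].
Qed.

Let O_leaf o : o \in [set a0] -> leaf T o.
Proof. by move/set1P->. Qed.

Let O_unmarked o : o \in [set a0] -> o \notin marked2 :|: marked3.
Proof.
move/set1P->; rewrite !inE a0c idx0 mark3_0 orbF /mark2.
by move: n4; case: (n %% 4) => [|[|[|k]]].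
Qed.

Let O_next o : o \in [set a0] -> parent (next c o) = parent o.
Proof. by move/set1P->; rewrite next_a0 nb_a0. Qed.

Let singleton (x v v' : V) : v \in [set x] -> v' \in [set x] -> v = v'.
Proof. by move=> /set1P-> /set1P->. Qed.

Let O_free o z a : o \in [set a0] -> cadj o z -> z \in marked3 -> a \in marked3 ->
  ~~ T (parent z) (parent a).
Proof. by move/set1P->; apply: cherry_free. Qed.

(** The parent of the leaves 0 and 1 gets the colour 2, and the leaf 0 is the one
    that keeps only its edges on the cycle. It relies on the leaf 1 being free to
    change its colour, so the next leaf must not be moved. *)
Lemma packing_mod12 : n %% 4 = 1 \/ n %% 4 = 2 ->
  next c a1 \notin moved T marked3 u -> packing_colorable [:: 1; 1; 2; 3] G.
Proof.
move=> n12 unmoved.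
apply: (@repaired_packing V G T c F GE marked2 marked3 u marked_leaf
  marked_disjoint marked_independent marked_gap2 marked_gap3 [set a0] [set u] set0
  O_leaf O_unmarked _ O_next (@singleton a0) O_free _ cherry_cover _ _ (@singleton u));
  do ?[by move=> o; rewrite in_set0 | by move=> o o'; rewrite in_set0].
- by move=> o /set1P->; rewrite nb_a0 !inE eqxx.
- by move=> o /set1P->; rewrite next_a0.
- by move=> o /set1P->.
move=> o v /set1P->; rewrite in_setU => /orP[v2|]; last exact: hub_far_u.
have [lv mv] := marked2_mark v2.
have far i : i = idx v -> ~ (i <= 2 \/ i.+1 = n).
  by move=> -> /(mark2_near n12); rewrite mv.
split.
  apply/negP => uv; apply: (far _ erefl); left.
  exact: ltnW (u_walk1 lv uv).
by move=> m um; apply/negP => mv'; apply: (far _ erefl); apply: u_walk2 um mv'.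
Qed.

(** The parent of the leaves 0 and 1 gets the colour 3. Along the cycle the leaves
    marked 3 are far from it, so that only walks of length 3 through [w] matter. *)
Lemma packing_mod3 : n %% 4 = 3 -> (forall v, v \in marked3 -> ~~ T w (parent v)) ->
  packing_colorable [:: 1; 1; 2; 3] G.
Proof.
move=> n3 w_free.
apply: (@repaired_packing V G T c F GE marked2 marked3 u marked_leaf
  marked_disjoint marked_independent marked_gap2 marked_gap3 [set a0] set0 [set u]
  O_leaf O_unmarked _ O_next (@singleton a0) O_free _ cherry_cover _ _ _ (@singleton u));
  do ?[by move=> o; rewrite in_set0 | by move=> o o'; rewrite in_set0].
- by move=> o /set1P->; rewrite nb_a0 !inE eqxx.
- move=> o /set1P->; rewrite next_a0; apply/negP => /moved3/marked3_mark[l2 m2].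
  have i2 : idx (next c a1) <= 2.
    have := cadj_next a1c; case/cadj_index => _ _ _ _; rewrite idx1.
    exact: adj_mod_from1 n2.
  by have := mark3_beyond n3 _ (or_introl (leqW i2)); rewrite m2 index_mem mem_next a1c => /(_ isT).
- by move=> o /set1P->.
- by move=> o /set1P->; apply: u_notin_hub.
move=> o v /set1P->; rewrite in_setD => /andP[_ v3].
have [lv mv] := marked3_mark v3.
have far : ~ (idx v <= 3 \/ n <= (idx v).+2).
  move=> far; have := mark3_beyond n3 _ far.
  by rewrite mv index_mem inc // => /(_ isT).
split.
- apply/negP => uv; apply: far; left.
  exact: leq_trans (ltnW (u_walk1 lv uv)) _.
- move=> m um; apply/negP => mv'; apply: far.
  by case: (u_walk2 lv um mv') => h; [left; apply: leqW|right; rewrite -h].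
move=> m m' um mm'; apply/negP => m'v.
case: (u_walk3 lv um mm' m'v) => h; do ?by apply: far; tauto.
by have := w_free v v3; rewrite h.
Qed.

Lemma leaf_of_w_unmoved b : n %% 4 = 2 -> leaf T b -> T w b -> b \notin moved T marked3 u.
Proof.
move=> n2' lb wb; apply/movedP => -[a /and4P[a3 b3 Tab uS]].
have [la ma] := marked3_mark a3.
have eb : parent b = w by rewrite -(parent_eq lb (p := w)) // Tsym.
rewrite eb in Tab uS; have wa : T w (parent a) by rewrite Tsym.
have eu : parent a = u.
  apply/eqP/negPn/negP => nu; rewrite eq_sym in nu.
  by have := side_disjoint treeT wu wa nu (mem_side _ _ _); rewrite uS.
have ua : T u a by rewrite -eu Tsym parentP.
case: (cherry_nbrs F iw uch ua) => e.
- by rewrite e (negbTE iw) in la.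
- by rewrite e idx0 mark3_0 in ma.
by move: ma; rewrite e idx1 => /mark3_1; rewrite n2'.
Qed.

Lemma near_cherry_unmoved x b b' : n %% 4 = 2 -> x != u -> T w x ->
  cherry T x w b b' -> idx b = 2 -> b \notin moved T marked3 u.
Proof.
move=> n2' xu wx xch ib; apply/movedP => -[a /and4P[a3 b3 Tab uS]].
have [[ix xw xb xb'] [lb lb' _]] := xch.
have [la ma] := marked3_mark a3.
have eb : parent b = x by rewrite -(parent_eq lb (p := x)) // Tsym.
rewrite eb in Tab uS; have xa : T x (parent a) by rewrite Tsym.
have nba := parent_internal F la.
case: (cherry_nbrs F iw xch xa) => ea; try by rewrite ea ?lb ?lb' in nba.
have wa : T w a by rewrite -ea Tsym parentP.
have [ia _] := mark3_near n4 (w_leaf_index wa la) ma.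
have ac := inc la; have eab : a = b by apply/eqP; rewrite -index_eqc // ia ib.
by rewrite eab eb in ea; rewrite ea adj_irrefl in xw.
Qed.

(** Otherwise the parents of [v] and [x] are adjacent and the cherry is the third
    branch between them. By [outer_leaf] the leaf 0 is next to [v], since it is
    not next to [x]; but none of its neighbours is marked 3. *)
Lemma y_leaf_free x y v : n %% 4 = 3 -> leaf T x -> T w x -> T w y ->
  y != x -> y != u -> idx x = 2 -> v \in marked3 -> parent v != y.
Proof.
move=> n3 lx wx wy yx yu ix v3; apply/eqP => vy.
have [lv mv] := marked3_mark v3.
have ex : parent x = w by rewrite -(parent_eq lx (p := w)) // Tsym.
have Tvx : T (parent v) (parent x) by rewrite vy ex Tsym.
have x2 : x \in marked2 by rewrite inE inc //= ix /mark2 n3.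
have nadj : ~~ cadj v x.
  by apply/negP => vx; have := marked_independent vx; rewrite !in_setU v3 x2 orbT => /(_ isT).
have Txu : T (parent x) u by rewrite ex.
have unv : u != parent v by rewrite vy eq_sym.
have ux : u != x by apply: contraNneq iu => ->.
have n5 : 3 < n.
  move: (ltn0Sn (idx v)); have : idx v < n by rewrite index_mem inc.
  by move: mv n3; rewrite /mark3; move: (idx v) n => i k; clear => + E; rewrite E /=; lia.
case: (outer_leaf F lv lx Tvx nadj Txu unv ux la0 ua0) => /cadj_index[_ _ _ iv];
  rewrite idx0 ?ix; last by move: n5; rewrite /adj_mod /succ_mod; clear; lia.
have := mv; move: n3 iv; rewrite /mark3 /adj_mod /succ_mod; move: (idx v) n => i k.
by clear => E; rewrite E /=; lia.
Qed.

End Marking.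

(** * Orienting the cycle *)

Lemma cycle_edge_rot (V : finType) (c : seq V) i : uniq c ->
  cycle_edge (rot i c) =2 cycle_edge c.
Proof. by move=> Uc a b; rewrite /cycle_edge /= !mem_rot !(next_rot _ Uc). Qed.

Lemma rot_next2 (V : finType) (c : seq V) a b d : uniq c -> 2 < size c ->
  a \in c -> next c a = b -> next c b = d -> exists i s, rot i c = [:: a, b, d & s].
Proof.
move=> Uc sc ac ab bd; have [i s' e] := rot_to ac.
have ne : b != a by rewrite -ab next_neq // ltnW.
move: sc ab bd; rewrite -(size_rot i) -!(next_rot i Uc) e.
case: s' e => [|b' [|d' s]] //= e _; rewrite !eqxx => eb.
rewrite eb (negbTE ne) eqxx => ed.
by exists i, s; rewrite e eb ed.
Qed.

Lemma rot_next3 (V : finType) (c : seq V) a b d f : uniq c -> 3 < size c ->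
  a \in c -> next c a = b -> next c b = d -> next c d = f ->
  exists i s, rot i c = [:: a, b, d, f & s].
Proof.
move=> Uc sc ac ab bd df; have [i [s' e]] := rot_next2 Uc (ltnW sc) ac ab bd.
have Ur : uniq (rot i c) by rewrite rot_uniq.
move: sc df; rewrite -(size_rot i) -(next_rot i Uc) e.
case: s' e => [|f' s] //= e _.
move: Ur; rewrite e /= !inE !negb_or => /and4P[/and4P[_ nad _ _] /and3P[nbd _ _] _ _].
rewrite (eq_sym d) (negbTE nad) (eq_sym d) (negbTE nbd) eqxx => ef.
by exists i, s; rewrite e ef.
Qed.

Section Orient.
Variables (V : finType) (T : sgraph V) (c : seq V).
Hypothesis F : halin_frame T c.
Implicit Types a b d e g l m o p q u v w x y z : V.
Let treeT := frame_tree F.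
Let Uc := frame_uniq F.
Let Tsym := adj_sym T.
Local Notation cadj := (cycle_edge c).
Local Notation parent := (parent T).

Lemma cherryC u w l l' : cherry T u w l l' -> cherry T u w l' l.
Proof. by case=> -[? ? ? ?] [? ? ?]; split; split; rewrite // eq_sym. Qed.

Lemma cherry_ordered u w l l' : cherry T u w l l' ->
  exists a0 a1, cherry T u w a0 a1 /\ next c a0 = a1.
Proof.
move=> ch; case/(cadjP F): (cherry_cadj F ch) => lc _ [e|e].
  by exists l, l'.
by exists l', l; split; [exact: cherryC | rewrite e (next_prev Uc)].
Qed.

(** The leaf [x] is next to the cherry by [cherry_third]; rotation and reversal of
    the cycle then bring the three leaves to its beginning. *)
Lemma orient_leaf u w x l l' : ~~ leaf T w -> cherry T u w l l' -> T w x -> leaf T x ->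
  exists c' a0 a1 s, [/\ halin_frame T c', cycle_edge c' =2 cadj,
    c' = [:: a0, a1, x & s] & cherry T u w a0 a1].
Proof.
move=> iw /cherry_ordered[a0 [a1 [ch n01]]] wx lx.
have [[iu uw ua0 ua1] [la0 la1 a01]] := ch.
have a0c : a0 \in c by rewrite (frame_leaf F).
have a1c : a1 \in c by rewrite (frame_leaf F).
have xnot a : T u a -> leaf T a -> x <> a.
  move=> ua la e; rewrite -e in ua la; move: uw.
  rewrite (parent_eq lx (p := u)) 1?Tsym // -(parent_eq lx (p := w)) 1?Tsym //.
  by rewrite adj_irrefl.
have sc := frame_size F.
have [e|e] : next c a1 = x \/ next c x = a0.
  case: (cherry_third F iw ch wx lx) => /(cadjP F)[_ _ []] e.
  - by right.
  - by case: (xnot a1 ua1 la1); rewrite -n01 e (next_prev Uc).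
  - by case: (xnot a0 ua0 la0); apply: (next_inj Uc); rewrite n01.
  by left; rewrite e (next_prev Uc).
- have [i [s es]] := rot_next2 Uc sc a0c n01 e.
  exists (rot i c), a0, a1, s; split=> //; [exact: frame_rot|exact: cycle_edge_rot].
have Ur : uniq (rev c) by rewrite rev_uniq.
have [||||i [s es]] := @rot_next2 V (rev c) a1 a0 x Ur _ _ _ _.
- by rewrite size_rev.
- by rewrite mem_rev.
- by rewrite (next_rev Uc) -n01 (prev_next Uc).
- by rewrite (next_rev Uc) -e (prev_next Uc).
exists (rot i (rev c)), a1, a0, s; split=> //; last exact: cherryC.
  exact/frame_rot/frame_rev.
by move=> a b; rewrite cycle_edge_rot // cycle_edge_rev.
Qed.

Lemma two_cherries_leaf u x y w l l' z z' v : ~~ leaf T w -> T w y ->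
  cherry T u w l l' -> cherry T x w z z' ->
  x != u -> y != u -> x != y ->
  leaf T v -> v \in side T y w -> [\/ v = l, v = l', v = z | v = z'].
Proof.
move=> iw wy uch xch xu yu xy lv vS.
have [[iu uw ul ul'] [ll ll' _]] := uch; have [[ix xw xz xz'] [lz lz' _]] := xch.
have wu : T w u by rewrite Tsym.
have wx : T w x by rewrite Tsym.
have ux : u != x by rewrite eq_sym.
have uy : u != y by rewrite eq_sym.
have [g [wg gu gx nbrs]] := third_nbr F iw wu wx ux.
have eg : g = y by case: (nbrs y wy) => // e; move: yu xy; rewrite e ?eqxx.
have yw : T y w by rewrite Tsym.
have vw : v != w by apply: contraNneq iw => <-.
have [e [we ey ve]] := side_split treeT yw vS vw.
have side_ch t d d' : cherry T t w d d' -> T w t -> v \in side T w t -> v = d \/ v = d'.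
  move=> tch wt vt; have [[it tw td td'] [ld ld' _]] := tch.
  have vnt : v != t by apply: contraNneq it => <-.
  have [f [tf fw vf]] := side_split treeT wt vt vnt.
  case: (cherry_nbrs F iw tch tf) => ef; rewrite ef ?eqxx // in tf vf fw.
    by left; apply: (leaf_side F tf ld).
  by right; apply: (leaf_side F tf ld').
case: (nbrs e we) => ee; rewrite ee in ve ey.
- by case: (side_ch u l l' uch wu ve); [constructor 1|constructor 2].
- by case: (side_ch x z z' xch wx ve); [constructor 3|constructor 4].
by rewrite eg eqxx in ey.
Qed.

(** The four leaves are those beyond the edge from [y] to [w], so they are
    consecutive, with siblings next to each other. *)
Lemma orient_cherries u x y w l l' z z' : ~~ leaf T w -> T w y ->
  cherry T u w l l' -> cherry T x w z z' -> x != u -> y != u -> x != y ->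
  exists c' a0 a1 a2 a3 s, [/\ halin_frame T c', cycle_edge c' =2 cadj,
    c' = [:: a0, a1, a2, a3 & s], cherry T u w a0 a1 & cherry T x w a2 a3].
Proof.
move=> iw wy /cherry_ordered[a0 [a1 [uch n01]]] /cherry_ordered[a2 [a3 [xch n23]]].
move=> xu yu xy.
have [[iu uw ua0 ua1] [la0 la1 a01]] := uch.
have [[ix xw xa2 xa3] [la2 la3 a23]] := xch.
have inc v : leaf T v -> v \in c by rewrite (frame_leaf F).
have wu : T w u by rewrite Tsym.
have wx : T w x by rewrite Tsym.
have uy : u != y by rewrite eq_sym.
have yw : T y w by rewrite Tsym.
have subu v : v \in side T w u -> v \in side T y w by apply: subsetP v; apply: side_sub.
have subx v : v \in side T w x -> v \in side T y w by apply: subsetP v; apply: side_sub.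
have nw a : leaf T a -> a != w by apply: contraTneq => ->.
have diff a b : T u a -> T x b -> leaf T a -> a != b.
  move=> ua xb la; apply: contraNneq xu => e; rewrite -e in xb.
  by rewrite (parent_eq la (p := x)) 1?Tsym // -(parent_eq la (p := u)) // Tsym.
have c4 : 3 < size c.
  apply: (@uniq_leq_size _ [:: a0; a1; a2; a3]).
    by rewrite /= !inE !negb_or a01 a23 !diff.
  by move=> v; rewrite !inE => /or4P[]/eqP->; apply: inc.
have sc := frame_size F.
have S v : leaf T v -> v \in side T y w -> [\/ v = a0, v = a1, v = a2 | v = a3].
  exact: (two_cherries_leaf iw wy uch xch).
have [e|e] : next c a1 = a2 \/ next c a3 = a0.
  have lnext v : leaf T v -> leaf T (next c v) by rewrite -!(frame_leaf F) mem_next.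
  have nself v : leaf T v -> next c v != v by move=> lv; rewrite next_neq ?inc // ltnW.
  have [S1|S1] := boolP (next c a1 \in side T y w).
    case: (S _ (lnext _ la1) S1) => e.
    - by have := next2_neq Uc sc (inc _ la0); rewrite n01 e eqxx.
    - by have := nself _ la1; rewrite e eqxx.
    - by left.
    by have := diff a1 a2 ua1 xa2 la1; rewrite (next_inj Uc (etrans e (esym n23))) eqxx.
  have [S3|S3] := boolP (next c a3 \in side T y w).
    case: (S _ (lnext _ la3) S3) => e.
    - by right.
    - by have := diff a0 a3 ua0 xa3 la0; rewrite (next_inj Uc (etrans n01 (esym e))) eqxx.
    - by have := next2_neq Uc sc (inc _ la2); rewrite n23 e eqxx.
    by have := nself _ la3; rewrite e eqxx.
  case/eqP: (diff a1 a3 ua1 xa3 la1); apply: (frame_arc F yw) => //; rewrite ?inc //.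
    by apply: subu; apply: (side_nbr F) => //; apply: nw.
  by apply: subx; apply: (side_nbr F) => //; apply: nw.
- have [i [s es]] := rot_next3 Uc c4 (inc _ la0) n01 e n23.
  exists (rot i c), a0, a1, a2, a3, s; split=> //; [exact: frame_rot|exact: cycle_edge_rot].
have Ur : uniq (rev c) by rewrite rev_uniq.
have [|||||i [s es]] := @rot_next3 V (rev c) a1 a0 a3 a2 Ur _ _ _ _ _.
- by rewrite size_rev.
- by rewrite mem_rev inc.
- by rewrite (next_rev Uc) -n01 (prev_next Uc).
- by rewrite (next_rev Uc) -e (prev_next Uc).
- by rewrite (next_rev Uc) -n23 (prev_next Uc).
exists (rot i (rev c)), a1, a0, a3, a2, s; split=> //; try exact: cherryC.
  exact/frame_rot/frame_rev.
by move=> a b; rewrite cycle_edge_rot // cycle_edge_rev.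
Qed.

End Orient.

(** * Cubic Halin graphs *)

Section TwoCherries.
Variables (V : finType) (T : sgraph V) (u x y w : V).
Hypotheses (iw : ~~ leaf T w) (wy : T w y).
Hypotheses (xu : x != u) (yu : y != u) (xy : x != y).
Let Tsym := adj_sym T.
Local Notation parent := (parent T).

(** If [y] has a leaf, then this leaf and the four leaves of the cherries are
    those beyond an edge at [y], hence consecutive. *)
Lemma beyond_cherries c a0 a1 a2 a3 s v : halin_frame T c ->
  c = [:: a0, a1, a2, a3 & s] ->
  cherry T u w a0 a1 -> cherry T x w a2 a3 -> leaf T v -> T y v ->
  index v c = 4 \/ (index v c).+1 = size c.
Proof.
move=> F ec uch xch lv yv; have Uc := frame_uniq F; have treeT := frame_tree F.
have [[iu uw ua0 ua1] [la0 la1 a01]] := uch.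
have [[ix xw xa2 xa3] [la2 la3 a23]] := xch.
have inc b : leaf T b -> b \in c by rewrite (frame_leaf F).
have wu : T w u by rewrite Tsym.
have wx : T w x by rewrite Tsym.
have yw : T y w by rewrite Tsym.
have nbv : parent v = y by rewrite -(parent_eq lv (p := y)) // Tsym.
have yint : ~~ leaf T y by rewrite -nbv (parent_internal F).
have vw : w != v by apply: contraNneq iw => ->.
have [g [yo ow ov nbrs]] := third_nbr F yint yw yv vw.
have oy : T g y by rewrite Tsym.
have vne b p : leaf T b -> T p b -> p != y -> b != v.
  move=> lb pb; apply: contraNneq => ebv; rewrite -nbv -ebv.
  by apply/eqP; apply: (parent_eq lb); rewrite Tsym.
have v0 := vne a0 u la0 ua0; have v1 := vne a1 u la1 ua1.
have v2 := vne a2 x la2 xa2; have v3 := vne a3 x la3 xa3.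
have uy : u != y by rewrite eq_sym.
have S b : leaf T b -> b \in side T g y -> [\/ b = a0, b = a1, b = a2 | b = a3] \/ b = v.
  move=> lb bS; have byn : b != y by apply: contraNneq yint => <-.
  have [e [ye eo be]] := side_split treeT oy bS byn.
  case: (nbrs e ye) => ee; rewrite ee ?eqxx // in ye be eo.
    by left; apply: (two_cherries_leaf F iw wy uch xch).
  by right; apply: (leaf_side F yv lv).
have sub b : b \in side T y w -> b \in side T g y.
  by apply: subsetP b; apply: side_sub; rewrite // eq_sym.
have a3S : a3 \in side T g y.
  apply: sub; apply: (subsetP (side_sub treeT yw wx xy)).
  by apply: (side_nbr F) => //; apply: contraNneq iw => <-.
have vS : v \in side T g y by apply: (side_nbr F); rewrite // eq_sym.
have i0 : index a0 c = 0 by rewrite ec /= eqxx.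
have Ur : uniq [:: a0, a1, a2, a3 & s] by rewrite -ec.
have i_nth i : i < 4 -> index (nth a0 [:: a0; a1; a2; a3] i) c = i.
  move=> i4; have -> : nth a0 [:: a0; a1; a2; a3] i = nth a0 c i.
    by rewrite ec; move: i i4 => [|[|[|[|]]]].
  by rewrite index_uniq // ec /=; apply: leq_trans i4 _.
have i1 := i_nth 1 isT; have i2 := i_nth 2 isT; have i3 := i_nth 3 isT.
rewrite /= in i1 i2 i3.
have idx_inj b d : leaf T b -> index b c = index d c -> b = d.
  move=> lb e; rewrite -(nth_index a0 (inc b lb)) e nth_index //.
  by rewrite -index_mem -e index_mem inc.
have inext b : leaf T b -> index (next c b) c = if (index b c).+1 == size c then 0 else (index b c).+1.
  by move=> lb; apply: index_next; rewrite ?inc.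
have lnext b : leaf T b -> leaf T (next c b) by rewrite -!(frame_leaf F) mem_next.
have vlt : index v c < size c by rewrite index_mem inc.
have [->|n4] := eqVneq (index v c) 4; [by left|right].
apply/eqP/negPn/negP => nlast.
have nexti b d : leaf T b -> next c b = d ->
    index d c = if (index b c).+1 == size c then 0 else (index b c).+1.
  by move=> lb <-; apply: inext.
have off b d i : leaf T b -> b != v -> index b c = i -> next c v = d -> index d c = i.+1 -> False.
  move=> lb bv ib nv id_; case/eqP: bv; apply: idx_inj => //.
  by have := nexti v d lv nv; rewrite (negbTE nlast) id_ ib; case.
have nvS : next c v \notin side T g y.
  apply/negP => /(S _ (lnext v lv))[[]|] e.
  - by have := nexti v _ lv e; rewrite (negbTE nlast) i0.
  - exact: (off a0 a1 0 la0 (v0 uy) i0 e i1).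
  - exact: (off a1 a2 1 la1 (v1 uy) i1 e i2).
  - exact: (off a2 a3 2 la2 (v2 xy) i2 e i3).
  by have := next_neq Uc (ltnW (frame_size F)) (inc v lv); rewrite e eqxx.
have n3S : next c a3 \notin side T g y.
  have h := nexti a3 _ la3 erefl.
  apply/negP => /(S _ (lnext a3 la3))[[]|] e; rewrite e i3 in h.
  - move: h; rewrite i0; case: eqP => // sz4 _.
    have iv : index v c < 4 by rewrite sz4.
    have ev : v = nth a0 [:: a0; a1; a2; a3] (index v c) by apply: idx_inj; rewrite ?i_nth.
    have v0' := v0 uy; have v1' := v1 uy; have v2' := v2 xy; have v3' := v3 xy.
    move: ev v0' v1' v2' v3'.
    by move: (index v c) iv => [|[|[|[|]]]] //= _ <-; rewrite eqxx.
  - by move: h; rewrite i1; case: eqP.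
  - by move: h; rewrite i2; case: eqP.
  - by move: h; case: eqP.
  move: h; case: eqP => // _ iv; last by rewrite iv eqxx in n4.
  by case/eqP: (v0 uy); apply: idx_inj; rewrite ?i0 ?iv.
by case/eqP: (v3 xy); apply: (frame_arc F oy); rewrite ?inc.
Qed.

End TwoCherries.

Section Main.
Variables (V : finType) (G T : sgraph V).
Let Tsym := adj_sym T.
Local Notation parent := (parent T).

Lemma two_cherries_mod3 c u x y w a0 a1 a2 a3 s : halin_frame T c ->
  (forall a b, G a b = T a b || cycle_edge c a b) ->
  ~~ leaf T w -> T w y -> x != u -> y != u -> x != y ->
  c = [:: a0, a1, a2, a3 & s] -> cherry T u w a0 a1 -> cherry T x w a2 a3 ->
  size c %% 4 = 3 -> (forall v, leaf T v -> T y v -> index v c != 4) ->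
  packing_colorable [:: 1; 1; 2; 3] G.
Proof.
move=> F GE iw wy xu yu xy ec uch xch n3 y4.
have n0 : 0 < size c %% 4 by rewrite n3.
have ec2 : c = [:: a0, a1 & [:: a2, a3 & s]] by [].
apply: (packing_mod3 F GE n0 ec2 uch iw n3) => v; rewrite inE => /andP[vc mv].
apply/negP => wv; have lv : leaf T v by rewrite -(frame_leaf F).
have Tvb : T (parent v) v by rewrite Tsym parentP.
have [[iu uw _ _] _] := uch; have [[ix xw _ _] _] := xch.
have wu : T w u by rewrite Tsym.
have wx : T w x by rewrite Tsym.
have ux : u != x by rewrite eq_sym.
have [g [wg gu gx nbrs]] := third_nbr F iw wu wx ux.
have eg : g = y by case: (nbrs y wy) => // e; move: yu xy; rewrite e ?eqxx.
have Ur : uniq [:: a0, a1, a2, a3 & s] by rewrite -ec (frame_uniq F).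
have idx i b : i < 4 -> b = nth a0 [:: a0; a1; a2; a3] i -> index b c = i.
  move=> i4 ->; have -> : nth a0 [:: a0; a1; a2; a3] i = nth a0 c i.
    by rewrite ec; move: i i4 => [|[|[|[|]]]].
  by rewrite index_uniq ?(frame_uniq F) // ec /=; apply: leq_trans i4 _.
have nbv := parent_internal F lv.
case: (nbrs _ wv) => e; rewrite e in Tvb nbv; move: mv; rewrite /mark3 n3 /=.
- case: (cherry_nbrs F iw uch Tvb) => ev.
  + by rewrite ev (negbTE iw) in lv.
  + by rewrite (idx 0 v) // ev.
  by rewrite (idx 1 v) // ev.
- case: (cherry_nbrs F iw xch Tvb) => ev.
  + by rewrite ev (negbTE iw) in lv.
  + by rewrite (idx 2 v) // ev.
  by rewrite (idx 3 v) // ev.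
rewrite eg in Tvb.
case: (beyond_cherries iw wy xu yu xy F ec uch xch lv Tvb) => iv.
  by have := y4 v lv Tvb; rewrite iv.
move: iv n3; move: (size c) (index v c) => n i; clear => <-; lia.
Qed.

(** What can fail is that [y] has a leaf with index 4, which is marked 3 and at
    distance 3 from [u]. Then exchange the cherries and read the cycle backwards.
    If [y] again has a leaf with index 4, there are six leaves in all, whereas
    their number is 3 modulo 4. *)
Lemma two_cherries_packing c u x y w l l' z z' : halin_frame T c ->
  (forall a b, G a b = T a b || cycle_edge c a b) -> size c %% 4 = 3 ->
  ~~ leaf T w -> T w y -> x != u -> y != u -> x != y ->
  cherry T u w l l' -> cherry T x w z z' ->
  packing_colorable [:: 1; 1; 2; 3] G.
Proof.
move=> F0 GE0 n3' iw wy xu yu xy uch0 xch0.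
have [c' [a0 [a1 [a2 [a3 [s [F ce ec uch xch]]]]]]] :=
  orient_cherries F0 iw wy uch0 xch0 xu yu xy.
have GE a b : G a b = T a b || cycle_edge c' a b by rewrite ce.
have sizeE : size c' = size c.
  rewrite -(card_uniqP (frame_uniq F)) -(card_uniqP (frame_uniq F0)).
  by apply: eq_card => v; rewrite (frame_leaf F) (frame_leaf F0).
have n3 : size c' %% 4 = 3 by rewrite sizeE.
have [/existsP[v /and3P[lv yv /eqP iv]]|no] :=
  boolP [exists v, [&& leaf T v, T y v & index v c' == 4]]; last first.
  apply: (two_cherries_mod3 F GE iw wy xu yu xy ec uch xch n3) => v lv yv.
  by apply/eqP => iv; case/existsP: no; exists v; rewrite lv yv iv eqxx.
have Uc := frame_uniq F; have treeT := frame_tree F.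
pose d := [:: a3, a2, a1, a0 & rev s].
have ed : d = rot (size s) (rev c').
  rewrite ec !rev_cons -!cats1 -!catA /=.
  by rewrite -(size_rev s) rot_size_cat.
have Fd : halin_frame T d by rewrite ed; apply/frame_rot/frame_rev.
have ced a b : cycle_edge d a b = cycle_edge c' a b.
  by rewrite ed cycle_edge_rot ?rev_uniq // cycle_edge_rev.
have ux : u != x by rewrite eq_sym.
have yx : y != x by rewrite eq_sym.
have uy : u != y by rewrite eq_sym.
apply: (two_cherries_mod3 (c := d) Fd _ iw wy ux yx uy erefl (cherryC xch) (cherryC uch)).
- by move=> a b; rewrite ced.
- by rewrite ed size_rot size_rev.
move=> v' lv' yv'; apply/eqP => iv'.
have yw : T y w by rewrite Tsym.
have inc b : leaf T b -> b \in c' by rewrite (frame_leaf F).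
have v'c := inc v' lv'; have vc := inc v lv.
have s2 : 2 < size s.
  move: n3 iv vc; rewrite -index_mem ec /=.
  by move: (size s) => k; clear => E -> ?; lia.
have s1 := ltnW s2; have s0 := ltnW s1.
have Ud : uniq d := frame_uniq Fd.
have v'last : v' = last v s.
  rewrite -(nth_index v (_ : v' \in d)) ?iv' /=; last first.
    by rewrite (frame_leaf Fd).
  by rewrite nth_rev // subn1 nth_last.
have v_first : v = nth v s 0.
  by rewrite -{1}(nth_index v vc) iv ec.
have vv' : v != v'.
  rewrite v_first v'last -nth_last; move: Uc; rewrite ec => /and5P[_ _ _ _ Us].
  rewrite nth_uniq // //; first by move: s2; case: (size s) => [|[|k]].
  by move: s2; case: (size s).
have yint : ~~ leaf T y.
  by rewrite (parent_eq lv (p := y)) 1?Tsym // (parent_internal F).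
have [g [yg gv gv' nbrs]] := third_nbr F yint yv yv' vv'.
have wv b : leaf T b -> w != b by move=> lb; apply: contraNneq iw => ->.
have eg : g = w by case: (nbrs w yw) => // e; [have := wv v lv|have := wv v' lv']; rewrite e eqxx.
pose b := nth v s 1.
have bs : b \in s by rewrite mem_nth.
have bc : b \in c' by rewrite ec !inE bs !orbT.
have lb : leaf T b by rewrite -(frame_leaf F).
move: (Uc); rewrite ec /= !inE !negb_or => /and5P[h0 h1 h2 h3 Us].
have bv : b != v.
  by rewrite v_first /b nth_uniq.
have bv' : b != v'.
  rewrite v'last -nth_last /b nth_uniq //; first by move: s2; case: (size s) => [|[|[|k]]].
  by move: s2; case: (size s).
have offs a : a \notin s -> b != a by apply: contraNneq => <-.
have [bS|bS] := boolP (b \in side T y w).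
  case: (two_cherries_leaf F iw wy uch xch xu yu xy lb bS) => e.
  - by case/and4P: h0 => _ _ _ /offs; rewrite e eqxx.
  - by case/and3P: h1 => _ _ /offs; rewrite e eqxx.
  - by case/andP: h2 => _ /offs; rewrite e eqxx.
  by have := offs a3 h3; rewrite e eqxx.
rewrite -in_setC -(sideC treeT yw) in bS.
have byn : b != y by apply: contraNneq yint => <-.
have [e [ye ew be]] := side_split treeT wy bS byn.
case: (nbrs e ye) => ee; rewrite ee in ye be ew.
- by move: bv; rewrite (leaf_side F ye lv be) eqxx.
- by move: bv'; rewrite (leaf_side F ye lv' be) eqxx.
by rewrite eg eqxx in ew.
Qed.

Lemma frame_packing c : halin_frame T c ->
  (forall a b, G a b = T a b || cycle_edge c a b) -> 4 < #|V| ->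
  packing_colorable [:: 1; 1; 2; 3] G.
Proof.
move=> F GE V5.
have [n0|n0] := posnP (size c %% 4); first exact: (packing_mod0 F GE).
have [u [w [x [y [l [l' [uch [iw wx wy] [xu yu xy] hx]]]]]]] := end_of_tree F V5.
have sizeE c' : halin_frame T c' -> size c' = size c.
  move=> F'; rewrite -(card_uniqP (frame_uniq F)) -(card_uniqP (frame_uniq F')).
  by apply: eq_card => v; rewrite (frame_leaf F) (frame_leaf F').
have n4 : [\/ size c %% 4 = 1, size c %% 4 = 2 | size c %% 4 = 3].
  move: n0 (ltn_mod (size c) 4); case: (size c %% 4) => [|[|[|[|k]]]] // _ _;
    by [constructor 1|constructor 2|constructor 3].
case: hx => [lx|[z [z' xch]]].
  have [c' [a0 [a1 [s [F' ce ec uch']]]]] := orient_leaf F iw uch wx lx.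
  have GE' a b : G a b = T a b || cycle_edge c' a b by rewrite ce.
  have n0' : 0 < size c' %% 4 by rewrite sizeE.
  have [[iu uw ua0 ua1] [la0 la1 a01]] := uch'.
  move: (frame_uniq F'); rewrite ec /= !inE !negb_or => /and3P[/and3P[_ a0x _] /andP[a1x _] _].
  have ix : index x c' = 2 by rewrite ec /= (negbTE a0x) (negbTE a1x) eqxx.
  have nx : next c' a1 = x by rewrite ec /= eq_sym (negbTE a01) eqxx.
  case: n4 => en.
  - have n12 : size c' %% 4 = 1 \/ size c' %% 4 = 2 by rewrite sizeE //; left.
  apply: (packing_mod12 F' GE' n0' ec uch' iw n12).
    apply/negP => /moved3; rewrite inE nx ix /mark3 sizeE // en /=.
    by rewrite andbF.
  - have n12 : size c' %% 4 = 1 \/ size c' %% 4 = 2 by rewrite sizeE //; right.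
  apply: (packing_mod12 F' GE' n0' ec uch' iw n12).
    by rewrite nx; apply: (leaf_of_w_unmoved F' ec uch' iw); rewrite // sizeE.
  have n3 : size c' %% 4 = 3 by rewrite sizeE.
  apply: (packing_mod3 F' GE' n0' ec uch' iw n3) => v v3.
  apply/negP => wv; move: (v3); rewrite inE => /andP[vc mv].
  have lv : leaf T v by rewrite -(frame_leaf F').
  have nbv := parent_internal F' lv.
  have wu : T w u by rewrite Tsym.
  have ux : u != x by rewrite eq_sym.
  have [g [wg gu gx nbrs]] := third_nbr F' iw wu wx ux.
  case: (nbrs _ wv) => e.
  - have uv : T u v by rewrite -e Tsym parentP.
    case: (cherry_nbrs F' iw uch' uv) => ev.
    + by rewrite ev (negbTE iw) in lv.
    + have i0 : index a0 c' = 0 by rewrite ec /= eqxx.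
      by rewrite ev i0 mark3_0 in mv.
    have i1 : index a1 c' = 1 by rewrite ec /= (negbTE a01) eqxx.
    by move: mv; rewrite ev i1 => /mark3_1; rewrite n3.
  - by rewrite e lx in nbv.
  have en' : size c' %% 4 = 3 by rewrite sizeE.
  have := y_leaf_free F' ec uch' en' lx wx wg gx gu ix v3.
  by rewrite e eqxx.
case: n4 => en; last exact: (two_cherries_packing F GE en iw wy xu yu xy uch xch).
  have [c' [a0 [a1 [a2 [a3 [s [F' ce ec uch' xch']]]]]]] :=
    orient_cherries F iw wy uch xch xu yu xy.
  have GE' a b : G a b = T a b || cycle_edge c' a b by rewrite ce.
  have n0' : 0 < size c' %% 4 by rewrite sizeE.
  have n12 : size c' %% 4 = 1 \/ size c' %% 4 = 2 by rewrite sizeE //; left.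
  apply: (packing_mod12 F' GE' n0' ec uch' iw n12).
  have [_ [la0 la1 a01]] := uch'.
  have [a02 a12] : a0 != a2 /\ a1 != a2.
    have := frame_uniq F'; rewrite ec /= !inE !negb_or.
    by case/and3P => /and3P[_ -> _] /andP[-> _].
  have ix : index a2 c' = 2 by rewrite ec /= (negbTE a02) (negbTE a12) eqxx.
  have nx : next c' a1 = a2 by rewrite ec /= eq_sym (negbTE a01) eqxx.
  by rewrite nx; apply/negP => /moved3; rewrite inE ix /mark3 sizeE // en /= andbF.
have [c' [a0 [a1 [a2 [a3 [s [F' ce ec uch' xch']]]]]]] :=
  orient_cherries F iw wy uch xch xu yu xy.
have GE' a b : G a b = T a b || cycle_edge c' a b by rewrite ce.
have n0' : 0 < size c' %% 4 by rewrite sizeE.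
have n12 : size c' %% 4 = 1 \/ size c' %% 4 = 2 by rewrite sizeE //; right.
apply: (packing_mod12 F' GE' n0' ec uch' iw n12).
have [_ [la0 la1 a01]] := uch'.
have [a02 a12] : a0 != a2 /\ a1 != a2.
    have := frame_uniq F'; rewrite ec /= !inE !negb_or.
    by case/and3P => /and3P[_ -> _] /andP[-> _].
have ix : index a2 c' = 2 by rewrite ec /= (negbTE a02) (negbTE a12) eqxx.
have nx : next c' a1 = a2 by rewrite ec /= eq_sym (negbTE a01) eqxx.
rewrite nx; apply: (near_cherry_unmoved F' n0' ec uch' iw _ xu wx xch' ix).
by rewrite sizeE.
Qed.

End Main.

(** Each vertex can have a class of its own. *)
Lemma small_packing (V : finType) (G : sgraph V) : #|V| <= 4 ->
  packing_colorable [:: 1; 1; 2; 3] G.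
Proof.
move=> V4; exists (fun i : 'I_4 => [set v | (enum_rank v : nat) == i]); split.
  move=> x; have lt4 : enum_rank x < 4 by apply: leq_trans (ltn_ord _) V4.
  exists (Ordinal lt4); split=> [|i]; first by rewrite inE.
  by rewrite inE => /eqP e; apply: val_inj.
move=> i u v; rewrite !inE => /eqP ui /eqP vi /eqP[].
by apply/enum_rank_inj/val_inj; rewrite /= ui vi.
Qed.

(** At an internal vertex all three edges belong to the tree. *)
Lemma halin_frame_cubic (R : realType) (V : finType) (G T : sgraph V) c :
  planar R G -> cubic G -> tree T ->
  uniq c -> 3 <= size c ->
  (forall x, (x \in c) = leaf T x) ->
  (forall x y, G x y = T x y || cycle_edge c x y) -> halin_frame T c.
Proof.
move=> planarG cubicG treeT Uc sc memc GE; split=> //.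
  move=> x ix; rewrite -(cubicG x) /degree; apply: eq_card => y.
  by rewrite !inE GE /cycle_edge /= memc (negbTE ix) orbF.
by move=> x y v w Txy vc vS nvS wc wS nwS; apply: (exit_unique treeT Uc memc GE planarG Txy).
Qed.

Theorem theorem2p1 (R : realType) (V : finType) (G : sgraph V)
    (halinG : halin R G) (cubicG : cubic G) :
  packing_colorable [:: 1; 1; 2; 3] G.
Proof.
have [planarG [T [c [[treeT _] _ [Uc sc] memc GE]]]] := halinG.
have F := halin_frame_cubic planarG cubicG treeT Uc sc memc GE.
have [V5|V5] := ltnP 4 #|V|; first exact: frame_packing F GE V5.
exact: small_packing.
Qed.
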